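(* Let $\mathcal H$ and $E_1,E_2,\dots$ be Hilbert spaces and let $S_\ell:E_\ell\to\mathcal H$ be bounded linear operators such that, with the notation of the context, $V_m=S^{(m)}(E^{(m)})$ is closed for every $m\ge1$. Assume that there are constants $0<\delta\le\Delta<\infty$ and $M,K<\infty$ such that for all $m,\ell$ $$\delta I\preceq D_\ell\preceq\Delta I\ \text{ on }E_\ell/\ker D_\ell,\qquad \|L_m\|\le M,\qquad\|L_m^{-1}\|\le K .$$ Set $A=\delta/K^2$, $B=\Delta M^2$ and $V=\overline{\bigcup_mV_m}$, and let $P_m$, $P_V$ be the orthogonal projections of $\mathcal H$ onto $V_m$, $V$. Let $S$ be the extension of the coefficient-to-function maps to the intrinsic (quotient) coefficient space $\widehat E$ of countably many levels. Then for every $f\in\mathcal H$: (i) $P_mf\to P_Vf$ as $m\to\infty$, and the minimum-norm quotient coefficient $c_m$ of $P_mf$ (the class $c_m\in E^{(m)}/\ker S^{(m)}$ with $S^{(m)}c_m=P_mf$) satisfies $\|c_m\|\le A^{-1/2}\|P_mf\|$; (ii) if the intrinsic coefficient $c\in\widehat E$ synthesizes $P_Vf$, i.e. $Sc=P_Vf$, and $Q_m$ truncates its quotient coordinates (keeping those of levels $1,\dots,m$), then $\|P_Vf-SQ_mc\|\le\sqrt B\,\|(I-Q_m)c\|$, the norm on the right being that of $\widehat E$; (iii) with $P_0=0$, $$\|f-P_mf\|^2=\|f-P_Vf\|^2+\sum_{\ell>m}\|P_\ell f-P_{\ell-1}f\|^2 .$$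
   Context: $E^{(m)}=\bigoplus_{\ell=1}^mE_\ell$ (Hilbert direct sum), $S^{(m)}c=\sum_{\ell=1}^mS_\ell c_\ell$, $V_m=S^{(m)}(E^{(m)})$, $V_0=\{0\}$. $P_{\ell-1}$ is the orthogonal projection onto $V_{\ell-1}$, $R_\ell=(I-P_{\ell-1})S_\ell$, and $D_\ell=R_\ell^*R_\ell$; $D_\ell$ also denotes the operator it induces on $E_\ell/\ker D_\ell\cong(\ker D_\ell)^\perp$. Quotients carry the quotient norm $\|[c]\|=\inf_z\|c+z\|$ ($z$ in the relevant kernel) and are identified as Hilbert spaces with the orthogonal complement of the kernel. $\widehat S^{(m)}$ is the injective map induced by $S^{(m)}$ on $E^{(m)}/\ker S^{(m)}$ (also written $S^{(m)}$). $R_\ell$ induces a bounded isomorphism $\widehat R_\ell:E_\ell/\ker D_\ell\to V_\ell\ominus V_{\ell-1}$, and there is a unique bounded isomorphism $C_m:E^{(m)}/\ker S^{(m)}\to\bigoplus_{\ell=1}^mE_\ell/\ker D_\ell$ with $\widehat S^{(m)}x=\sum_{\ell=1}^m\widehat R_\ell(C_mx)_\ell$ for all $x$; $L_m=C_m^*$. Under the stated hypotheses, $A\|[c]\|^2\le\|S^{(m)}c\|^2\le B\|[c]\|^2$ for all $m$ and $c\in E^{(m)}$, $[c]$ being the class modulo $\ker S^{(m)}$. Hence the maps $S^{(m)}$ extend by density to a bounded operator on $\bigoplus_{\ell\ge1}E_\ell$ (Hilbert direct sum); $\widehat E$ is the quotient of this sum by the kernel of the extension, with quotient norm, and $S:\widehat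 E\to\mathcal H$ is the induced map. It is bounded below by $\sqrt\delta/K=\sqrt A$ and bounded above by $\sqrt B$, with closed image. The quotient coordinates of $c\in\widehat E$ are the elements $x_\ell\in E_\ell/\ker D_\ell$ with $Sc=\sum_{\ell\ge1}\widehat R_\ell x_\ell$ (the countable-level version of the coordinates given by $C_m$); $Q_mc\in\widehat E$ is the element whose coordinates are $x_1,\dots,x_m,0,0,\dots$. *)

(* Defs.v *)
From HB Require Import structures.
From mathcomp Require Import all_boot all_order all_algebra.
From mathcomp Require Import all_classical all_reals all_analysis.
From mathcomp Require Import complex.

Set Implicit Arguments.
Unset Strict Implicit.
Unset Printing Implicit Defensive.

Import Order.TTheory GRing.Theory Num.Theory.
Import numFieldNormedType.Exports.

Local Open Scope classical_set_scope.
Local Open Scope ring_scope.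

(* The scalar field is either R itself or R[i]; all norms, bounds and constants
   are real numbers in R. *)
Variant scalar_kind := RealScalars | ComplexScalars.

Definition scalar_field (R : realType) (k : scalar_kind) : numFieldType :=
  match k with RealScalars => R | ComplexScalars => R[i] end.

Definition sconj (R : realType) (k : scalar_kind) :
    scalar_field R k -> scalar_field R k :=
  match k with
  | RealScalars => fun z => z
  | ComplexScalars => fun z : R[i] => conjc z
  end.

Definition re (R : realType) (k : scalar_kind) : scalar_field R k -> R :=
  match k with
  | RealScalars => fun z => z
  | ComplexScalars => fun z : R[i] => complex.Re z
  end.

(* Hilbert spaces: Banach spaces whose norm comes from an inner product, which
   is linear in its first argument and conjugate-linear in its second. *)
HB.mixin Record isHilbert (R : realType) (k : scalar_kind) H
    of CompleteNormedModule (scalar_field R k) H := {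
  inner : {dot H for @sconj R k} ;
  inner_norm : forall x : H, inner x x = `|x| ^+ 2
}.

#[short(type="hilbertType")]
HB.structure Definition Hilbert (R : realType) (k : scalar_kind) :=
  {H of CompleteNormedModule (scalar_field R k) H & isHilbert R k H}.

(* The library norm takes its values in the scalar field. *)
Definition nrm (R : realType) (k : scalar_kind) (H : hilbertType R k) (x : H)
  : R := re `|x|.
Arguments nrm {R k H} x.

Section Operators.
Context (R : realType) (k : scalar_kind).
Local Notation K := (scalar_field R k).

(* [opnorm nT nU X f] is the operator norm of f : X -> U, for a linear subspace
   X of T; it is +oo when f is unbounded on X. *)
Definition opnorm (T U : Type) (nT : T -> R) (nU : U -> R) (X : set T)
    (f : T -> U) : \bar R :=
  ereal_sup [set (nU (f x))%:E | x in [set x | X x /\ nT x <= 1]].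

Definition bounded_operator (E H : hilbertType R k) (f : E -> H) : Prop :=
  (opnorm (fun x : E => nrm x) (fun y : H => nrm y) setT f < +oo)%E.

(* [adjoint dT dU X x0 f] is the adjoint of f : X -> U with respect to the
   inner products dT and dU; it takes its values in X (x0 is a dummy default). *)
Definition adjoint (T : choiceType) (U : Type) (dT : T -> T -> K)
    (dU : U -> U -> K) (X : set T) (x0 : T) (f : T -> U) (y : U) : T :=
  xget x0 [set x | X x /\ forall z, X z -> dU (f z) y = dT z x].

(* Orthogonal complement of N in X: the Hilbert space X / N, whose quotient norm
   is then the restriction of the norm of X. *)
Definition quot (T : Type) (d : T -> T -> K) (X N : set T) : set T :=
  [set x | X x /\ forall z, N z -> d x z = 0].

Definition orth_proj (H : hilbertType R k) (W : set H) (f : H) : H :=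
  xget 0 [set p | W p /\ forall w, W w -> inner (f - p) w = 0].

End Operators.

Section Families.
Context (R : realType) (k : scalar_kind) (E : nat -> hilbertType R k).

Definition fam : Type := forall l, E l.

Definition fzero : fam := fun=> 0.
Definition fsub (c d : fam) : fam := fun l => c l - d l.
Definition flin (a : scalar_field R k) (c d : fam) : fam :=
  fun l => a *: c l + d l.
Definition ftrunc (m : nat) (c : fam) : fam :=
  fun l => if (l < m)%N then c l else 0.

Definition fsq (c : fam) : \bar R := (\sum_(0 <= l <oo) (nrm (c l) ^+ 2)%:E)%E.

(* The Hilbert direct sum of all the E l. *)
Definition l2sum : set fam := [set c | (fsq c < +oo)%E].

Definition fnorm (c : fam) : R := Num.sqrt (fine (fsq c)).
Definition fdot (c d : fam) : scalar_field R k :=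
  limn (fun n => \sum_(l < n) inner (c l) (d l)).

(* The sum of the first m spaces, as a subspace of the sum of all of them. *)
Definition finsum (m : nat) : set fam :=
  [set c | forall l, (m <= l)%N -> c l = 0].

End Families.
Arguments fnorm {R k E} c.
Arguments fdot {R k E} c d.
Arguments l2sum {R k E} _.
Arguments fzero {R k E} _.

(* Levels are numbered from 0: E l, S l, Rop l and D l belong to level l + 1,
   whereas V m, P m, C m and L m involve the m levels 0, ..., m - 1. *)
Section Multilevel.
Context (R : realType) (k : scalar_kind) (H : hilbertType R k)
  (E : nat -> hilbertType R k) (S : forall l, {linear E l -> H}).

Definition Sfin (m : nat) (c : fam E) : H := \sum_(l < m) S l (c l).

Definition V (m : nat) : set H := Sfin m @` finsum m.
Definition Vinf : set H := closure (\bigcup_m V m).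
Definition P (m : nat) : H -> H := orth_proj (V m).
Definition PV : H -> H := orth_proj Vinf.

Definition Rop (l : nat) (x : E l) : H := S l x - P l (S l x).
Definition D (l : nat) : E l -> E l :=
  fun x => adjoint inner inner setT 0 (@Rop l) (Rop x).

(* E_l / ker D_l, the sum of the first m of these, and E^(m) / ker S^(m). *)
Definition quotE (l : nat) : set (E l) :=
  quot inner setT [set z | D z = 0].
Definition quotEsum (m : nat) : set (fam E) :=
  [set y | finsum m y /\ forall l, (l < m)%N -> quotE (y l)].
Definition quotS (m : nat) : set (fam E) :=
  quot fdot (finsum m) [set z | finsum m z /\ Sfin m z = 0].

(* C is the bounded isomorphism C_m; only its values on quotS m matter. The
   class of x in E_l / ker D_l is represented by x in quotE l, so that the
   induced map of Rop on it is Rop itself. *)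
Definition is_coordinate_iso (m : nat) (C : fam E -> fam E) : Prop :=
  [/\ set_bij (quotS m) (quotEsum m) C,
      forall a x y, quotS m x -> quotS m y ->
        C (flin a x y) = flin a (C x) (C y),
      (opnorm fnorm fnorm (quotS m) C < +oo)%E,
      (opnorm fnorm fnorm (quotEsum m)
         ('pinv_(fun=> fzero) (quotS m) C) < +oo)%E &
      forall x, quotS m x -> Sfin m x = \sum_(l < m) Rop (C x l)].

(* L_m = C_m^*, its inverse, and their operator norms. *)
Definition L (m : nat) (C : fam E -> fam E) : fam E -> fam E :=
  adjoint fdot fdot (quotS m) fzero C.
Definition Linv (m : nat) (C : fam E -> fam E) : fam E -> fam E :=
  'pinv_(fun=> fzero) (quotEsum m) (L m C).

Definition norm_L (m : nat) (C : fam E -> fam E) : \bar R :=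
  opnorm fnorm fnorm (quotEsum m) (L m C).
Definition norm_Linv (m : nat) (C : fam E -> fam E) : \bar R :=
  opnorm fnorm fnorm (quotS m) (Linv m C).

(* The bounded linear extension of the maps S^(m) to the whole direct sum;
   such a map is determined on l2sum, and its values elsewhere are irrelevant. *)
Definition is_extension (T : fam E -> H) : Prop :=
  [/\ forall a c d, l2sum c -> l2sum d -> T (flin a c d) = a *: T c + T d,
      (opnorm fnorm nrm l2sum T < +oo)%E &
      forall m c, finsum m c -> T c = Sfin m c].
Definition Sinf : fam E -> H := xget (fun=> 0) is_extension.

Definition Ehat : set (fam E) :=
  quot fdot l2sum [set z | l2sum z /\ Sinf z = 0].

(* x is the family of quotient coordinates of c in Ehat. *)
Definition is_coords (c x : fam E) : Prop :=
  (forall l, quotE (x l)) /\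
  (fun n => \sum_(l < n) Rop (x l)) @ \oo --> Sinf c.

Definition Q (m : nat) (c : fam E) : fam E :=
  xget fzero
    [set d | Ehat d /\ exists2 x, is_coords c x & is_coords d (ftrunc m x)].

End Multilevel.

(* Main.v *)
(** The vectors [Rop l (x l)] are pairwise orthogonal, so the squared norm of
    [Sfin m c] is the sum over [l < m] of [<D y_l, y_l>] with [y = C c]; the bounds
    on [D], and the bounds on [C] and its inverse that come from their adjoints,
    give the frame inequalities of [Sfin m] on [E^(m) / ker S^(m)].  The lower one
    is the bound on the minimum-norm coefficient.  The upper one passes to [Sinf]
    by density, and the truncation estimate is this bound applied to [c - Q m c].
    The projections [P m] converge because the [V m] increase to a dense subspace
    of [Vinf], and the error identity is a telescoping sum of Pythagoras
    identities.  Existence of the adjoints and projections is the Riesz theorem,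
    proved for complete subspaces of a semi-inner product space. *)

Require Import Defs.
From HB Require Import structures.
From mathcomp Require Import all_boot all_order all_algebra.
From mathcomp Require Import all_classical all_reals all_analysis.
From mathcomp Require Import complex ring lra.

Set Implicit Arguments.
Unset Strict Implicit.
Unset Printing Implicit Defensive.

Import Order.TTheory GRing.Theory Num.Theory.
Import numFieldNormedType.Exports.

Local Open Scope classical_set_scope.
Local Open Scope ring_scope.

(** * Real parts, conjugation and the embedding of [R], uniformly for real and complex scalars *)

Section Scalars.
Context (R : realType) (k : scalar_kind).
Local Notation K := (scalar_field R k).
Implicit Types (z w : K) (r s : R).

Definition ofR : R -> K :=
  match k with
  | RealScalars => fun r => r
  | ComplexScalars => fun r => (r +i* 0)%C
  end.

Lemma reD : {morph @re R k : z w / z + w}.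
Proof. by case: k => //= [[a b]] [c d]. Qed.

Lemma reN : {morph @re R k : z / - z}.
Proof. by case: k => //= [[a b]]. Qed.

Lemma re0 : re (0 : K) = 0.
Proof. by case: k. Qed.

Lemma reB : {morph @re R k : z w / z - w}.
Proof. by move=> z w; rewrite reD reN. Qed.

Lemma re_sum (I : Type) (r : seq I) (p : pred I) (F : I -> K) :
  re (\sum_(i <- r | p i) F i) = \sum_(i <- r | p i) re (F i).
Proof. exact: (big_morph _ reD re0). Qed.

Lemma reM r z : re (ofR r * z) = r * re z.
Proof. by rewrite /ofR /re; case: k z => //= -[a b] /=; rewrite mul0r subr0. Qed.

Lemma re_ofR r : re (ofR r) = r.
Proof. by rewrite /ofR /re; case: k. Qed.

Lemma ofR0 : ofR 0 = 0. Proof. by rewrite /ofR; case: k. Qed.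

Lemma ofR1 : ofR 1 = 1. Proof. by rewrite /ofR; case: k. Qed.

Lemma ofRM : {morph ofR : r s / r * s}.
Proof.
rewrite /ofR; case: k => //= r s; apply/eqP; rewrite eq_complex /=.
by apply/andP; split; apply/eqP; ring.
Qed.

Lemma ofRD : {morph ofR : r s / r + s}.
Proof.
by rewrite /ofR; case: k => //= r s; apply/eqP; rewrite eq_complex /= addr0 !eqxx.
Qed.

Lemma ofRN : {morph ofR : r / - r}.
Proof.
by rewrite /ofR; case: k => //= r; apply/eqP; rewrite eq_complex /= oppr0 !eqxx.
Qed.

Lemma lt_ofR r s : (ofR r < ofR s) = (r < s).
Proof. by rewrite /ofR; case: k => //=; rewrite ltcE /= eqxx. Qed.

Lemma le_ofR r s : (ofR r <= ofR s) = (r <= s).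
Proof. by rewrite /ofR; case: k => //=; rewrite lecE /= eqxx. Qed.

(** The order of [R[i]] forces a nonnegative scalar to have zero imaginary part; this is how
    scalar-valued norms and radii are read as real numbers. *)
Lemma ofR_re z : 0 <= z -> ofR (re z) = z.
Proof.
by rewrite /ofR /re; case: k z => //= -[a b]; rewrite lecE /= => /andP[/eqP ->].
Qed.

Lemma sconjD : {morph @sconj R k : z w / z + w}.
Proof. by rewrite /sconj; case: k => //= z w; rewrite rmorphD. Qed.

Lemma sconjM : {morph @sconj R k : z w / z * w}.
Proof. by rewrite /sconj; case: k => //= z w; rewrite rmorphM. Qed.

Lemma sconj_ofR r : sconj (ofR r) = ofR r.
Proof. by rewrite /sconj /ofR; case: k => //=; rewrite oppr0. Qed.

Lemma re_sconj z : re (sconj z) = re z.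
Proof. by rewrite /re /sconj; case: k z => //= -[]. Qed.

Lemma sconjK : involutive (@sconj R k).
Proof. by rewrite /sconj; case: k => //= -[a b] /=; rewrite opprK. Qed.

Lemma sconj_real z : sconj z = z -> z = ofR (re z).
Proof.
rewrite /sconj /ofR /re; case: k z => //= -[a b] /= [] /eqP.
by rewrite -subr_eq0 -opprD oppr_eq0 -mulr2n mulrn_eq0 /= => /eqP ->.
Qed.

Lemma re_conj_ge0 z : 0 <= re (z * sconj z).
Proof.
rewrite /re /sconj; case: k z => /= [x|[a b] /=]; first by rewrite -expr2 sqr_ge0.
by rewrite mulrN opprK addr_ge0 // -expr2 sqr_ge0.
Qed.

Lemma conj_real z : z * sconj z = ofR (re (z * sconj z)).
Proof. by apply: sconj_real; rewrite sconjM sconjK mulrC. Qed.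

Lemma re_conj_eq0 z : re (z * sconj z) = 0 -> z = 0.
Proof.
rewrite /re /sconj; case: k z => /= [x /eqP|[a b] /= /eqP].
  by rewrite mulf_eq0 orbb => /eqP.
rewrite mulrN opprK paddr_eq0 -?expr2 ?sqr_ge0 // !sqrf_eq0.
by move=> /andP[/eqP -> /eqP ->].
Qed.

(** Take [a] to be the conjugate of [z]. Scalar identities thereby reduce to identities between real
    parts. *)
Lemma re_mul_eq0 z : (forall a, re (a * z) = 0) -> z = 0.
Proof. by move=> h; apply: re_conj_eq0; rewrite mulrC h. Qed.

End Scalars.
Arguments ofR {R k}.

(** * Semi-inner products: Cauchy-Schwarz, closed kernels and the Riesz theorem *)

Section SemiInner.
Context (R : realType) (k : scalar_kind).
Local Notation K := (scalar_field R k).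
Context (T : lmodType K) (dot : T -> T -> K).

(** Definiteness is left out so that [dotn m], which ignores the levels from [m] on, qualifies on
    the space of all families. *)
Definition semi_inner :=
  [/\ forall a x y z, dot (a *: x + y) z = a * dot x z + dot y z,
      forall x y, dot y x = sconj (dot x y) &
      forall x, 0 <= re (dot x x)].

Definition sqn (x : T) : R := re (dot x x).

Definition subspace (X : set T) :=
  X 0 /\ forall a x y, X x -> X y -> X (a *: x + y).

Definition sqn_cvg (u : nat -> T) (x : T) :=
  forall e : R, 0 < e -> exists N, forall n, (N <= n)%N -> sqn (u n - x) < e.

(** Phrased with sequences and squared norms because [T] is a bare module without topology. *)
Definition complete_in (X : set T) :=
  forall u : nat -> T, (forall n, X (u n)) ->
    (forall e : R, 0 < e -> exists N, forall i j, (N <= i)%N -> (N <= j)%N ->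
       sqn (u i - u j) < e) ->
  exists2 x, X x & sqn_cvg u x.

(* Boundedness of the real part suffices, since the functional is linear. *)
Definition bounded_functional (X : set T) (phi : T -> K) :=
  (forall a x y, X x -> X y -> phi (a *: x + y) = a * phi x + phi y) /\
  exists b, forall x, X x -> re (phi x) ^+ 2 <= b * sqn x.

Hypothesis dotP : semi_inner.
Implicit Types (x y z : T) (a : K) (r : R) (X : set T).

Lemma dotDl x y z : dot (x + y) z = dot x z + dot y z.
Proof. by case: dotP => h _ _; rewrite -[x]scale1r h mul1r scale1r. Qed.

Lemma dot0l z : dot 0 z = 0.
Proof. by apply: (addrI (dot 0 z)); rewrite -dotDl !addr0. Qed.

Lemma dotZl a x z : dot (a *: x) z = a * dot x z.
Proof. by case: dotP => h _ _; rewrite -[a *: x]addr0 h dot0l addr0. Qed.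

Lemma dotNl x z : dot (- x) z = - dot x z.
Proof. by rewrite -scaleN1r dotZl mulN1r. Qed.

Lemma dotBl x y z : dot (x - y) z = dot x z - dot y z.
Proof. by rewrite dotDl dotNl. Qed.

Lemma dotC x y : dot y x = sconj (dot x y).
Proof. by have [] := dotP. Qed.

Lemma dotDr x y z : dot x (y + z) = dot x y + dot x z.
Proof. by rewrite dotC dotDl sconjD -!dotC. Qed.

Lemma dotZr a x z : dot x (a *: z) = sconj a * dot x z.
Proof. by rewrite dotC dotZl sconjM -dotC. Qed.

Lemma re_dotC x y : re (dot x y) = re (dot y x).
Proof. by rewrite dotC re_sconj. Qed.

Lemma dotxx x : dot x x = ofR (sqn x).
Proof. by apply: sconj_real; rewrite -dotC. Qed.

Lemma sqn_ge0 x : 0 <= sqn x.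
Proof. by have [_ _ h] := dotP; exact: h. Qed.

Lemma sqnD x y : sqn (x + y) = sqn x + 2 * re (dot x y) + sqn y.
Proof. by rewrite /sqn dotDl !dotDr !reD (re_dotC y x); ring. Qed.

Lemma sqnZ a x : sqn (a *: x) = re (a * sconj a) * sqn x.
Proof.
by rewrite {1}/sqn dotZl dotZr mulrA dotxx conj_real -ofRM !re_ofR.
Qed.

Lemma sqnZR r x : sqn (ofR r *: x) = r ^+ 2 * sqn x.
Proof. by rewrite sqnZ sconj_ofR -ofRM re_ofR. Qed.

Lemma sqnN x : sqn (- x) = sqn x.
Proof. by rewrite -scaleN1r -[1](ofR1 R k) -ofRN sqnZR sqrrN expr1n mul1r. Qed.

Lemma re_dotBr x y z : re (dot x (y - z)) = re (dot x y) - re (dot x z).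
Proof. by rewrite re_dotC dotBl reB !(re_dotC _ x). Qed.

Lemma sqnB x y : sqn (x - y) = sqn x - 2 * re (dot x y) + sqn y.
Proof. by rewrite sqnD sqnN -[- y]sub0r re_dotBr (re_dotC x 0) dot0l re0; ring. Qed.

(** A quadratic without sign change has nonpositive discriminant. This gives Cauchy-Schwarz and, in
    [riesz], the estimate at a near-minimizer. *)
Lemma discriminant_le (a b c : R) :
  0 <= c -> (forall t, 0 <= a + 2 * t * b + t ^+ 2 * c) -> b ^+ 2 <= a * c.
Proof.
rewrite le_eqVlt => /predU1P[<-|c_gt0] h.
  have [->|b0] := eqVneq b 0; first by rewrite expr0n mulr0.
  (* With [c = 0] and [b != 0], the affine function takes the value -1 here. *)
  have := h (- (a + 1) / (2 * b)).
  have -> : a + 2 * (- (a + 1) / (2 * b)) * b + (- (a + 1) / (2 * b)) ^+ 2 * 0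
    = - 1 by field.
  by rewrite oppr_ge0 ler10.
(* The vertex of the parabola. *)
have := h (- b / c).
have -> : a + 2 * (- b / c) * b + (- b / c) ^+ 2 * c = (a * c - b ^+ 2) / c.
  by field; rewrite gt_eqF.
by rewrite pmulr_lge0 ?invr_gt0 // subr_ge0.
Qed.

Lemma cauchy_schwarz x y : re (dot x y) ^+ 2 <= sqn x * sqn y.
Proof.
apply: discriminant_le => [|t]; first exact: sqn_ge0.
suff <- : sqn (x + ofR t *: y) = sqn x + 2 * t * re (dot x y) + t ^+ 2 * sqn y.
  exact: sqn_ge0.
by rewrite sqnD sqnZR dotZr sconj_ofR reM; ring.
Qed.

Lemma subspaceZ X a x : subspace X -> X x -> X (a *: x).
Proof. by case=> X0 XL Xx; rewrite -[_ *: _]addr0; exact: XL. Qed.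

Lemma subspaceD X x y : subspace X -> X x -> X y -> X (x + y).
Proof. by case=> X0 XL Xx Xy; rewrite -[x]scale1r; exact: XL. Qed.

Lemma subspaceB X x y : subspace X -> X x -> X y -> X (x - y).
Proof. by case=> X0 XL Xx Xy; rewrite addrC -scaleN1r; exact: XL. Qed.

Lemma bounded_functional_dot X y : bounded_functional X (dot ^~ y).
Proof.
split=> [a u v _ _|]; first by case: dotP.
by exists (sqn y) => x _; rewrite mulrC; exact: cauchy_schwarz.
Qed.

Section Functional.
Context (X : set T) (phi : T -> K).
Hypotheses (subX : subspace X) (bphi : bounded_functional X phi).

Lemma functional0 : phi 0 = 0.
Proof.
case: bphi => phiL _; case: subX => X0 _.
have := phiL 1 0 0 X0 X0; rewrite scale1r addr0 mul1r => /eqP.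
by rewrite -subr_eq0 opprD addrA subrr sub0r oppr_eq0 => /eqP.
Qed.

Lemma functionalZ a x : X x -> phi (a *: x) = a * phi x.
Proof.
move=> Xx; case: bphi => phiL _; case: subX => X0 _.
by rewrite -[_ *: _]addr0 phiL // functional0 addr0.
Qed.

Lemma functionalB x y : X x -> X y -> phi (x - y) = phi x - phi y.
Proof.
move=> Xx Xy; case: bphi => phiL _.
by rewrite addrC -scaleN1r phiL // mulN1r addrC.
Qed.

End Functional.

(** The limit [x] found in [X] stays in each kernel: [phi i (u N) = 0], so [phi i x] is controlled
    by the distance from [u N] to [x]. *)
Lemma complete_in_kernel X (I : Type) (phi : I -> T -> K) :
  subspace X -> complete_in X -> (forall i, bounded_functional X (phi i)) ->
  complete_in [set x | X x /\ forall i, phi i x = 0].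
Proof.
move=> subX compX bphi u Xu cu.
have [x Xx ux] := compX u (fun n => (Xu n).1) cu.
exists x => //; split=> // i; apply: re_mul_eq0 => a.
have [b hb] := (bphi i).2.
(* [c] dominates [b] times the squared modulus of [a]; the 1 makes it positive. *)
pose c := `|b| * re (a * sconj a) + 1.
have c_gt0 : 0 < c by rewrite ltr_wpDl ?mulr_ge0 ?re_conj_ge0.
apply/eqP; rewrite -sqrf_eq0 eq_le sqr_ge0 andbT.
apply/ler_addgt0Pl => e e_gt0; rewrite addr0.
have [N /(_ N (leqnn N)) hN] := ux (e / c) (divr_gt0 e_gt0 c_gt0).
have XxN : X (u N - x) by apply: subspaceB => //; exact: (Xu N).1.
have -> : a * phi i x = phi i (- a *: (u N - x)).
  rewrite (functionalZ subX (bphi i)) // (functionalB (bphi i)) //; last first.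
    exact: (Xu N).1.
  by rewrite (Xu N).2 sub0r mulrNN.
apply: le_trans (hb _ (subspaceZ _ subX XxN)) _.
rewrite scaleNr sqnN sqnZ; rewrite ltr_pdivlMr // in hN.
apply: le_trans (ltW hN); rewrite mulrA mulrC ler_wpM2l ?sqn_ge0 // /c.
by rewrite -[leLHS]addr0 lerD ?ler01 // ler_wpM2r ?re_conj_ge0 ?ler_norm.
Qed.

(* [y] minimizes [x |-> sqn x - 2 * re (phi x)] over [X]. *)
Lemma riesz X (phi : T -> K) :
  subspace X -> complete_in X -> bounded_functional X phi ->
  exists2 y, X y & forall z, X z -> phi z = dot z y.
Proof.
move=> subX compX bphi; have [phiL [b hb]] := bphi.
have X0 : X 0 by case: subX.
pose J x := sqn x - 2 * re (phi x).
have JD x w t : X x -> X w ->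
    J (x + ofR t *: w) = J x + 2 * t * (re (dot x w) - re (phi w)) + t ^+ 2 * sqn w.
  move=> Xx Xw; rewrite /J [in phi _]addrC phiL // sqnD sqnZR dotZr sconj_ofR.
  by rewrite reD !reM; ring.
have Jlb x : X x -> - `|b| <= J x.
  move=> Xx; rewrite /J; have := sqn_ge0 x.
  have : re (phi x) ^+ 2 <= `|b| * sqn x.
    by rewrite (le_trans (hb _ Xx)) // ler_wpM2r ?sqn_ge0 ?ler_norm.
  move: (normr_ge0 b); move: (sqn x) (re (phi x)) `|b| => s p c c0 hp s0.
  (* Arithmetic-geometric mean inequality: [p ^+ 2 <= c * s] gives [2 * p <= c + s]. *)
  suff : 2 * p <= c + s by lra.
  have [p0|p0] := ltP p 0; first by lra.
  rewrite -ler_sqr ?nnegrE ?mulr_ge0 ?addr_ge0 //.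
  by have := sqr_ge0 (c - s); lra.
pose A := J @` X.
have hA : has_inf A.
  by split; [exists (J 0), 0|exists (- `|b|) => _ [x Xx <-]; exact: Jlb].
have /choice[u hu] : forall n, exists x, X x /\ J x < inf A + n.+1%:R^-1.
  move=> n; have [_ [x Xx <-] hx] := @inf_adherent _ A n.+1%:R^-1
    (ltac:(by rewrite invr_gt0)) hA.
  by exists x.
have Jinf x : X x -> inf A <= J x.
  by move=> Xx; apply: ge_inf; [exact: hA.2|exists x].
have small (e : R) : 0 < e -> exists N, forall n, (N <= n)%N -> n.+1%:R^-1 < e.
  move=> e0; have [N _ hN] := near_infty_natSinv_lt (PosNum e0).
  by exists N => n; exact: hN.
(* A minimizing sequence is Cauchy: at the midpoint of [u i] and [u j], [J] is the mean of the two
   values minus a quarter of [sqn (u i - u j)], and it is at least [inf A]. *)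
have cu (e : R) : 0 < e -> exists N, forall i j, (N <= i)%N -> (N <= j)%N ->
    sqn (u i - u j) < e.
  move=> e0; have [N hN] := small (e / 4) (ltac:(by rewrite divr_gt0)).
  exists N => i j /hN hi /hN hj.
  have [Xi hui] := hu i; have [Xj huj] := hu j.
  have Xij : X (u i - u j) by exact: subspaceB.
  have := Jinf _ (subspaceD subX Xj (subspaceZ (ofR 2^-1) subX Xij)).
  have := JD _ _ 1 Xj Xij; rewrite (JD _ _ 2^-1) //.
  rewrite ofR1 scale1r addrCA subrr addr0.
  move: (re _ - re _) (sqn _) (inf A) (J (u i)) (J (u j)) hui huj hi hj.
  move: (i.+1%:R^-1) (j.+1%:R^-1) => ei ej g v m Ji Jj; lra.
have [y Xy uy] := compX u (fun n => (hu n).1) cu.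
exists y => // z Xz; apply/eqP; rewrite eq_sym -subr_eq0; apply/eqP.
apply: re_mul_eq0 => a.
have Xw : X (a *: z) by exact: subspaceZ.
rewrite mulrBr -dotZl -(functionalZ subX bphi) // reB.
move: {z Xz} (a *: z) Xw => w Xw.
apply/eqP; rewrite -sqrf_eq0 eq_le sqr_ge0 andbT.
apply/ler_addgt0Pl => e e0; rewrite addr0.
(* The residual at [y] is compared with the one at [u n]; two errors of square at most [d * sqn w]
   add up to one of square at most [4 * d * sqn w]. *)
have w1 : 0 < 4 * (sqn w + 1) by rewrite mulr_gt0 // ltr_wpDl ?sqn_ge0.
pose d := e / (4 * (sqn w + 1)); have d0 : 0 < d by rewrite divr_gt0.
have [N1 hN1] := small d d0; have [N2 hN2] := uy d d0.
pose n := maxn N1 N2.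
have {hN1} hd : n.+1%:R^-1 < d by apply: hN1; exact: leq_maxl.
have {hN2} hy : sqn (u n - y) < d by apply: hN2; exact: leq_maxr.
have [Xn hn] := hu n.
(* Along the line [u n + t w], [J - inf A] is a nonnegative quadratic in [t]. *)
have h1 : (re (dot (u n) w) - re (phi w)) ^+ 2 <= (J (u n) - inf A) * sqn w.
  apply: discriminant_le => [|t]; first exact: sqn_ge0.
  have := Jinf _ (subspaceD subX Xn (subspaceZ (ofR t) subX Xw)).
  by rewrite JD // -subr_ge0; congr (_ <= _); ring.
have h2 := cauchy_schwarz w (u n - y).
have h3 : re (dot w (u n - y)) = re (dot (u n) w) - re (dot w y).
  by rewrite re_dotBr (re_dotC w (u n)).
have h4 : (J (u n) - inf A) * sqn w <= d * sqn w.
  by rewrite ler_wpM2r ?sqn_ge0 // lerBlDl (le_trans (ltW hn)) // lerD2l ltW.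
have h5 : sqn w * sqn (u n - y) <= d * sqn w.
  by rewrite mulrC ler_wpM2r ?sqn_ge0 // ltW.
have h6 : 4 * (d * sqn w) <= e.
  rewrite [leRHS](_ : e = d * (4 * (sqn w + 1))); last by rewrite /d divfK ?gt_eqF.
  by rewrite mulrCA ler_wpM2l ?(ltW d0) // ler_wpM2l // lerDl ler01.
have sqr_le (p q r c : R) : (p - q) ^+ 2 <= c -> (p - r) ^+ 2 <= c ->
    (r - q) ^+ 2 <= 4 * c.
  by move=> hq hr; have := sqr_ge0 ((p - q) + (p - r)); lra.
apply: le_trans h6; apply: sqr_le (le_trans h1 h4) _.
by rewrite -h3 (le_trans h2 h5).
Qed.

End SemiInner.

(** * Orthogonal complements and existence of projections *)

Section Complement.
Context (R : realType) (k : scalar_kind).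
Local Notation K := (scalar_field R k).
Context (T : lmodType K) (dot : T -> T -> K).
Hypothesis dotP : semi_inner dot.
Implicit Types (x y z : T) (X N : set T).

Lemma sqnD_orth x y : dot x y = 0 -> sqn dot (x + y) = sqn dot x + sqn dot y.
Proof. by move=> h; rewrite sqnD // h re0 mulr0 addr0. Qed.

Lemma dot0r x : dot x 0 = 0.
Proof. by rewrite (dotC dotP) (dot0l dotP) -[0](ofR0 R k) sconj_ofR. Qed.

Lemma orth_sym x y : dot x y = 0 -> dot y x = 0.
Proof. by move=> h; rewrite (dotC dotP) h -(dot0r 0) -(dotC dotP). Qed.

(** The projection is the Riesz representative of [dot ^~ f] on [X]. *)
Lemma projection_exists X f : subspace X -> complete_in dot X ->
  exists p, X p /\ forall w, X w -> dot (f - p) w = 0.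
Proof.
move=> subX compX.
have [p Xp hp] := riesz dotP subX compX (bounded_functional_dot dotP X f).
exists p; split=> // w Xw.
rewrite (dotBl dotP) (dotC dotP w f) hp // -(dotC dotP); exact: subrr.
Qed.

Lemma subspace_quot X N : subspace X -> subspace (quot dot X N).
Proof.
move=> [X0 XL]; split; first by split=> // z _; rewrite (dot0l dotP).
move=> a x y [Xx hx] [Xy hy]; split; first exact: XL.
by move=> z Nz; have [-> _ _] := dotP; rewrite hx // hy // mulr0 addr0.
Qed.

(** The complement of [N] is the common kernel of the functionals [dot ^~ z], [z] in [N]. *)
Lemma complete_in_quot X N :
  subspace X -> complete_in dot X -> complete_in dot (quot dot X N).
Proof.
move=> subX compX.
rewrite (_ : quot _ _ _ =
    [set x | X x /\ forall i : {z | N z}, dot x (sval i) = 0]); last first.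
  apply/seteqP; split=> x [Xx hx]; split=> //.
    by case=> z Nz; exact: hx.
  by move=> z Nz; exact: (hx (exist _ z Nz)).
apply: (complete_in_kernel dotP) => // i; exact: bounded_functional_dot.
Qed.

End Complement.
Arguments complete_in_quot {R k T dot} dotP {X N} _ _ u _ _.

(** * Adjoints of bounded maps on complete subspaces *)

Section Adjoint.
Context (R : realType) (k : scalar_kind).
Local Notation K := (scalar_field R k).
Context (T U : lmodType K) (dT : T -> T -> K) (dU : U -> U -> K).
Hypotheses (dTP : semi_inner dT) (dUP : semi_inner dU).

Definition bounded_linear (X : set T) (f : T -> U) :=
  (forall a x y, X x -> X y -> f (a *: x + y) = a *: f x + f y) /\
  exists b, forall x, X x -> sqn dU (f x) <= b * sqn dT x.

Lemma bounded_functional_comp X f y :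
  bounded_linear X f -> bounded_functional dT X (fun z => dU (f z) y).
Proof.
move=> [fL [b hb]]; split=> [a u v Xu Xv|].
  by rewrite fL //; have [-> _ _] := dUP.
exists (b * sqn dU y) => x Xx; rewrite (le_trans (cauchy_schwarz dUP _ _)) //.
by rewrite mulrAC ler_wpM2r ?hb // sqn_ge0.
Qed.

(** The Riesz representative of [z |-> dU (f z) y] witnesses the predicate in [adjoint], so [xget]
    does not fall back on [x0]. *)
Lemma adjointP X x0 f y :
  subspace X -> complete_in dT X -> bounded_linear X f ->
  X (adjoint dT dU X x0 f y) /\
  forall z, X z -> dU (f z) y = dT z (adjoint dT dU X x0 f y).
Proof.
move=> subX compX bf.
have [x Xx hx] := riesz dTP subX compX (bounded_functional_comp y bf).
apply: (@xgetPex _ x0 [set x | X x /\ forall z, X z -> dU (f z) y = dT z x]).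
by exists x.
Qed.

End Adjoint.

(** * From the operator norm to pointwise bounds *)

Section OperatorNorm.
Context (R : realType).

Lemma opnorm_ge (T U : Type) (nT : T -> R) (nU : U -> R) (X : set T) (f : T -> U)
    b x :
  (opnorm nT nU X f <= b%:E)%E -> X x -> nT x <= 1 -> nU (f x) <= b.
Proof.
by move=> fb Xx x1; rewrite -lee_fin (le_trans _ fb) //; apply: ereal_sup_ubound;
  exists x.
Qed.

Lemma opnorm_fin (T U : Type) (nT : T -> R) (nU : U -> R) (X : set T)
    (f : T -> U) :
  (opnorm nT nU X f < +oo)%E -> exists b, (opnorm nT nU X f <= b%:E)%E.
Proof.
(* The value [-oo] arises when [X] has no point of norm at most 1. *)
by case: (opnorm _ _ _ _) => [r| |] // _; [exists r|exists 0; rewrite leNye].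
Qed.

(** Dividing [x] by [nT x + d] with [d > 0] also handles vectors of norm zero; [d] is then made
    small. The scaling [sc] is a parameter because [T] is an arbitrary type. *)
Lemma opnorm_bound (T U : Type) (nT : T -> R) (nU : U -> R) (X : set T)
    (f : T -> U) (sc : R -> T -> T) b :
  (forall (r : R) x, 0 < r -> X x ->
     [/\ X (sc r x), nT (sc r x) = r * nT x & nU (f (sc r x)) = r * nU (f x)]) ->
  (forall x, 0 <= nT x) -> (forall y, 0 <= nU y) ->
  (opnorm nT nU X f <= b%:E)%E -> forall x, X x -> nU (f x) <= b * nT x.
Proof.
move=> hsc nT0 nU0 fb x Xx.
have scaled (s : R) : 0 < s -> s * nT x <= 1 -> s * nU (f x) <= b.
  move=> s0 hs; have [Xs sT <-] := hsc _ _ s0 Xx.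
  by apply: opnorm_ge fb Xs _; rewrite sT.
have b0 : 0 <= b.
  have s0 : 0 < (nT x + 1)^-1 by rewrite invr_gt0 ltr_wpDl.
  rewrite (le_trans _ (scaled _ s0 _)) ?mulr_ge0 ?(ltW s0) //.
  by rewrite mulrC ler_pdivrMr ?ltr_wpDl // mul1r lerDl ler01.
apply/ler_addgt0Pr => e e0.
(* Chosen so that [b * d <= e]. *)
pose d := e / (b + 1); have d0 : 0 < d by rewrite divr_gt0 // ltr_wpDl.
have s0 : 0 < (nT x + d)^-1 by rewrite invr_gt0 ltr_wpDl.
have := scaled _ s0; rewrite mulrC ler_pdivrMr ?ltr_wpDl // mul1r lerDl ltW //.
move=> /(_ isT); rewrite mulrC ler_pdivrMr ?ltr_wpDl // mulrDr => /le_trans; apply.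
rewrite lerD2l /d mulrA ler_pdivrMr ?ltr_wpDl // mulrC.
by rewrite ler_wpM2l ?(ltW e0) // lerDl ler01.
Qed.

End OperatorNorm.

(** * Hilbert spaces as instances of the semi-inner product theory *)

Section HilbertSpaces.
Context (R : realType) (k : scalar_kind) (H : hilbertType R k).
Local Notation K := (scalar_field R k).
Implicit Types (x y : H) (W : set H).

Lemma inner_semi : semi_inner (@inner R k H).
Proof.
split=> [a x y z|x y|x].
- exact: linearPl.
- by rewrite [LHS](hermitian_subproof (s := @inner R k H)) expr0 mul1r.
- by rewrite inner_norm -(ofR_re (normr_ge0 x)) expr2 -ofRM re_ofR -expr2 sqr_ge0.
Qed.

Lemma ofR_nrm x : ofR (nrm x) = `|x|.
Proof. exact: ofR_re (normr_ge0 x). Qed.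

Lemma nrm_ge0 x : 0 <= nrm x.
Proof. by rewrite -(le_ofR k) ofR0 ofR_nrm normr_ge0. Qed.

Lemma sqn_inner x : sqn inner x = nrm x ^+ 2.
Proof. by rewrite /sqn inner_norm -ofR_nrm expr2 -ofRM re_ofR. Qed.

Lemma nrm0_eq0 x : nrm x = 0 -> x = 0.
Proof. by move=> h; apply/normr0_eq0; rewrite -ofR_nrm h ofR0. Qed.

Lemma nrm0 : nrm (0 : H) = 0.
Proof. by rewrite /nrm normr0 re0. Qed.

Lemma nrmZR (r : R) x : 0 <= r -> nrm (ofR r *: x) = r * nrm x.
Proof.
move=> r0; apply/eqP; rewrite -(@eqrXn2 _ 2) ?mulr_ge0 ?nrm_ge0 //.
by rewrite -sqn_inner (sqnZR inner_semi) exprMn sqn_inner.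
Qed.

Lemma ler_nrmD x y : nrm (x + y) <= nrm x + nrm y.
Proof.
by rewrite -(le_ofR k) ofR_nrm (_ : ofR _ = `|x| + `|y|) ?ler_normD //
  -!ofR_nrm; exact: ofRD.
Qed.

(** Bridge between convergence along filters, whose radii are scalars, and the sequential notion
    with real radii. *)
Lemma sqn_cvgP (u : nat -> H) x : u @ \oo --> x <-> sqn_cvg inner u x.
Proof.
split.
  move=> /cvgrPdist_lt ux e e0.
  have s0 : 0 < Num.sqrt e by rewrite sqrtr_gt0.
  have [N _ hN] := ux (ofR (Num.sqrt e)) (ltac:(by rewrite -(ofR0 R k) lt_ofR)).
  exists N => n /hN /=; rewrite distrC -ofR_nrm lt_ofR sqn_inner => hn.
  by rewrite -[ltRHS]sqr_sqrtr ?(ltW e0) // ltr_sqr ?nnegrE ?nrm_ge0 ?ltW.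
move=> ux; apply/cvgrPdist_lt => e e0.
have e1 : 0 < re e by rewrite -(lt_ofR k) ofR0 ofR_re // ltW.
have [N hN] := ux (re e ^+ 2) (exprn_gt0 2 e1).
exists N => // n /= /hN; rewrite sqn_inner distrC -ofR_nrm => h.
rewrite -(ofR_re (ltW e0)) lt_ofR; move: h.
by rewrite ltr_sqr ?nnegrE ?nrm_ge0 ?ltW.
Qed.

Lemma closed_complete_in W : closed W -> complete_in inner W.
Proof.
move=> cW u Wu cu.
have /cauchy_cvg ux : cauchy (u @ \oo).
  apply/cauchy_ballP => e e0.
  have e1 : 0 < re e by rewrite -(lt_ofR k) ofR0 ofR_re // ltW.
  have [N hN] := cu (re e ^+ 2) (exprn_gt0 2 e1).
  pose A := u @` [set n | (N <= n)%N].
  exists (A, A); first by split; exists N => // n ?; exists n.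
  move=> [_ _] [/= [i hi <-] [j hj <-]]; have := hN _ _ hi hj.
  rewrite sqn_inner -ball_normE /= -ofR_nrm => h.
  rewrite -(ofR_re (ltW e0)) lt_ofR; move: h.
  by rewrite ltr_sqr ?nnegrE ?nrm_ge0 ?ltW.
exists (lim (u @ \oo)); last exact/sqn_cvgP.
by apply: (@closed_cvg _ _ _ _ u W cW _ _ ux); exact: nearW.
Qed.

End HilbertSpaces.
Arguments closed_complete_in [R k H W] _ u _ _.

(** * Families as a module with pointwise operations, and the finite direct sums *)

Section DirectSums.
Context (R : realType) (k : scalar_kind) (E : nat -> hilbertType R k).
Local Notation K := (scalar_field R k).
Local Notation fam := (fam E).
Implicit Types (c d x : fam) (m : nat).

Let fadd c d : fam := fun l => c l + d l.
Let fopp c : fam := fun l => - c l.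
Let fscale (a : K) c : fam := fun l => a *: c l.

Let faddA : associative fadd.
Proof. by move=> x y z; apply/functional_extensionality_dep => l; exact: addrA. Qed.
Let faddC : commutative fadd.
Proof. by move=> x y; apply/functional_extensionality_dep => l; exact: addrC. Qed.
Let fadd0 : left_id fzero fadd.
Proof. by move=> x; apply/functional_extensionality_dep => l; exact: add0r. Qed.
Let faddN : left_inverse fzero fopp fadd.
Proof. by move=> x; apply/functional_extensionality_dep => l; exact: addNr. Qed.

HB.instance Definition _ := Choice.copy fam (forall l, E l).
HB.instance Definition _ :=
  GRing.isZmodule.Build fam faddA faddC fadd0 faddN.

Let fscaleA a b c : fscale a (fscale b c) = fscale (a * b) c.
Proof. by apply/functional_extensionality_dep => l; exact: scalerA. Qed.
Let fscale1 : left_id 1 fscale.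
Proof. by move=> c; apply/functional_extensionality_dep => l; exact: scale1r. Qed.
Let fscaleDr : right_distributive fscale +%R.
Proof.
by move=> a c d; apply/functional_extensionality_dep => l; exact: scalerDr.
Qed.
Let fscaleDl c : {morph fscale ^~ c : a b / a + b}.
Proof. by move=> a b; apply/functional_extensionality_dep => l; exact: scalerDl. Qed.

HB.instance Definition _ :=
  GRing.Zmodule_isLmodule.Build K fam fscaleA fscale1 fscaleDr fscaleDl.

Lemma flinE a c d : flin a c d = a *: c + d. Proof. by []. Qed.

(** Finite substitute for [fdot]: the two agree on [finsum m], where this form is also definite. *)
Definition dotn m c d : K := \sum_(l < m) inner (c l) (d l).

Lemma dotn_semi m : semi_inner (dotn m).
Proof.
split=> [a x y z|x y|x]; rewrite /dotn.
- rewrite mulr_sumr -big_split; apply: eq_bigr => l _ /=.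
  by have [-> _ _] := inner_semi (E l).
- rewrite (big_morph (@sconj R k) (@sconjD R k) (id1 := 0)).
    by apply: eq_bigr => l _; exact: dotC (inner_semi (E l)) _ _.
  by rewrite -[0](ofR0 R k) sconj_ofR.
- by rewrite re_sum; apply: sumr_ge0 => l _; exact: sqn_ge0 (inner_semi (E l)) _.
Qed.

Lemma sqn_dotn m c : sqn (dotn m) c = \sum_(l < m) nrm (c l) ^+ 2.
Proof. by rewrite /sqn re_sum; apply: eq_bigr => l _; rewrite -sqn_inner. Qed.

Lemma fdotE m c d : finsum m c -> fdot c d = dotn m c d.
Proof.
move=> cm; apply: lim_near_cst => //; exists m => // n /= mn.
rewrite /dotn -(subnKC mn) big_split_ord /= [X in _ + X]big1 ?addr0 // => l _.
by rewrite cm ?leq_addr // (dot0l (inner_semi _)).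
Qed.

Lemma fsqE m c : finsum m c -> fsq c = (sqn (dotn m) c)%:E.
Proof.
move=> cm; rewrite /fsq (nneseries_split 0 m) => [|l _]; last first.
  by rewrite lee_fin sqr_ge0.
rewrite eseries0 ?adde0; last first.
  by move=> l ml _; rewrite cm // nrm0 expr0n.
by rewrite sqn_dotn add0n big_mkord sumEFin.
Qed.

Lemma fnormE m c : finsum m c -> fnorm c = Num.sqrt (sqn (dotn m) c).
Proof. by move=> cm; rewrite /fnorm (fsqE cm). Qed.

Lemma fnorm_ge0 c : 0 <= fnorm c. Proof. exact: sqrtr_ge0. Qed.

Lemma finsum_l2sum m : finsum m `<=` @l2sum R k E.
Proof. by move=> c cm; rewrite /l2sum /= (fsqE cm) ltry. Qed.

Lemma subspace_finsum m : subspace (@finsum R k E m).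
Proof.
split=> [l _|a x y hx hy l ml] //=.
by rewrite [LHS](_ : _ = a *: x l + y l) // hx // hy // scaler0 addr0.
Qed.

Lemma dotn_definite m c : finsum m c -> sqn (dotn m) c = 0 -> c = 0.
Proof.
move=> cm; rewrite sqn_dotn => /eqP.
rewrite psumr_eq0 => [/allP h|l _]; last by rewrite sqr_ge0.
apply/functional_extensionality_dep => l; have [lm|/cm -> //] := ltnP l m.
have := h (Ordinal lm) (mem_index_enum _); rewrite /= sqrf_eq0 => /eqP.
exact: nrm0_eq0.
Qed.

(** Each coordinate is Cauchy because its squared norm is one term of [sqn (dotn m)]. Limits are
    taken level by level, and convergence of the sum follows by induction on the number of
    levels. *)
Lemma complete_in_finsum m : complete_in (dotn m) (finsum m).
Proof.
move=> u um cu.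
have hx l : {x : E l | ((l < m)%N -> sqn_cvg inner (fun n => u n l) x) /\
    ((m <= l)%N -> x = 0)}.
  apply: cid; have [lm|ml] := ltnP l m; last by exists 0.
  have [x _ ux] : exists2 x, setT x & sqn_cvg inner (fun n => u n l) x.
    apply: (closed_complete_in closedT) => // e e0.
    have [N hN] := cu e e0; exists N => i j hi hj.
    apply: le_lt_trans (hN i j hi hj).
    rewrite sqn_dotn (bigD1 (Ordinal lm)) //= sqn_inner lerDl.
    by apply: sumr_ge0 => *; rewrite sqr_ge0.
  by exists x.
pose x : fam := fun l => sval (hx l).
exists x => [l ml|]; first exact: (svalP (hx l)).2.
suff h j : (j <= m)%N -> sqn_cvg (dotn j) u x by exact: h.
elim: j => [_ e e0|j IH jm e e0].
  by exists 0%N => n _; rewrite sqn_dotn big_ord0.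
have e2 : 0 < e / 2 by rewrite divr_gt0.
have [N1 h1] := IH (ltnW jm) _ e2; have [N2 h2] := (svalP (hx j)).1 jm _ e2.
exists (maxn N1 N2) => n; rewrite geq_max => /andP[/h1 {}h1 /h2 {}h2].
rewrite sqn_dotn big_ord_recr /= -sqn_dotn -sqn_inner [ltRHS](splitr e).
exact: ltrD.
Qed.

End DirectSums.
Arguments complete_in_finsum {R k E} m u _ _.

(** * Orthogonal projections onto closed subspaces *)

Section OrthogonalProjection.
Context (R : realType) (k : scalar_kind) (H : hilbertType R k) (W : set H).
Hypotheses (subW : subspace W) (clW : closed W).
Implicit Types f p w : H.

Lemma orth_projP f :
  W (orth_proj W f) /\ forall w, W w -> inner (f - orth_proj W f) w = 0.
Proof.
apply: (@xgetPex _ 0 [set p | W p /\ forall w, W w -> inner (f - p) w = 0]).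
exact: (projection_exists (inner_semi H) f subW (closed_complete_in clW)).
Qed.

(** The difference of two candidates lies in [W] and is orthogonal to [W], hence to itself. *)
Lemma orth_proj_unique f p :
  W p -> (forall w, W w -> inner (f - p) w = 0) -> orth_proj W f = p.
Proof.
move=> Wp hp; have [Wq hq] := orth_projP f.
apply/eqP; rewrite -subr_eq0; apply/eqP/nrm0_eq0/eqP.
rewrite -sqrf_eq0 -sqn_inner /sqn.
have Wd : W (orth_proj W f - p) by exact: subspaceB.
have -> : inner (orth_proj W f - p) (orth_proj W f - p) =
    inner ((f - p) - (f - orth_proj W f)) (orth_proj W f - p).
  by congr (inner _ _); rewrite opprB [RHS]addrC addrA subrK.
by rewrite (dotBl (inner_semi H)) hp // hq // subrr re0.
Qed.

Lemma orth_proj_linear a f g :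
  orth_proj W (a *: f + g) = a *: orth_proj W f + orth_proj W g.
Proof.
have [Wf hf] := orth_projP f; have [Wg hg] := orth_projP g.
apply: orth_proj_unique => [|w Ww]; first by case: subW => _; apply.
have -> : a *: f + g - (a *: orth_proj W f + orth_proj W g) =
    a *: (f - orth_proj W f) + (g - orth_proj W g).
  by rewrite scalerBr opprD addrACA.
by have [-> _ _] := inner_semi H; rewrite hf // hg // mulr0 addr0.
Qed.

(* Pythagoras: [f - w] is the sum of orthogonal vectors [f - p] and [p - w]. *)
Lemma orth_proj_pythagoras f w : W w ->
  nrm (f - w) ^+ 2 = nrm (f - orth_proj W f) ^+ 2 + nrm (orth_proj W f - w) ^+ 2.
Proof.
move=> Ww; have [Wp hp] := orth_projP f.
rewrite -!sqn_inner -(sqnD_orth (inner_semi H)); last first.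
  by rewrite hp //; exact: subspaceB.
by congr sqn; rewrite addrA subrK.
Qed.

Lemma nrm_sub_orth_proj_le f : nrm (f - orth_proj W f) ^+ 2 <= nrm f ^+ 2.
Proof.
have W0 : W 0 by case: subW.
by have := orth_proj_pythagoras f W0; rewrite subr0 => ->; rewrite lerDl sqr_ge0.
Qed.

End OrthogonalProjection.

(** The kernel of [f] is the common kernel of the scalar functionals [z |-> inner (f z) h]. *)
Lemma complete_in_ker (R : realType) (k : scalar_kind)
    (T : lmodType (scalar_field R k)) (U : hilbertType R k)
    (d : T -> T -> scalar_field R k) (X : set T) (f : T -> U) :
  semi_inner d -> subspace X -> complete_in d X -> bounded_linear d inner X f ->
  complete_in d [set z | X z /\ f z = 0].
Proof.
move=> dP subX compX bf.
rewrite (_ : [set z | _] = [set z | X z /\ forall h, inner (f z) h = 0]).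
  apply: complete_in_kernel => // h.
  exact: (bounded_functional_comp (inner_semi U) _ bf).
apply/seteqP; split=> z [Xz hz]; split=> //.
  by move=> h; rewrite hz (dot0l (inner_semi U)).
by apply/nrm0_eq0/eqP; rewrite -sqrf_eq0 -sqn_inner /sqn hz re0.
Qed.

(** * The spaces [V m] and the orthogonality of the level increments *)

Section Levels.
Context (R : realType) (k : scalar_kind) (H : hilbertType R k)
  (E : nat -> hilbertType R k) (S : forall l, {linear E l -> H}).
Hypotheses (S_bounded : forall l, bounded_operator (S l))
  (V_closed : forall m, (0 < m)%N -> closed (V S m)).
Let HI := inner_semi H.

Lemma Sfin_linear m a c d : Sfin S m (a *: c + d) = a *: Sfin S m c + Sfin S m d.
Proof.
rewrite /Sfin scaler_sumr -big_split; apply: eq_bigr => l _.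
exact: linearP.
Qed.

Lemma Sfin0 c : Sfin S 0 c = 0. Proof. exact: big_ord0. Qed.

Lemma SfinE m n c : finsum m c -> (m <= n)%N -> Sfin S n c = Sfin S m c.
Proof.
move=> cm mn; rewrite /Sfin -(subnKC mn) big_split_ord /= [X in _ + X]big1 ?addr0 //.
by move=> l _; rewrite cm ?leq_addr // linear0.
Qed.

Lemma finsum_le m n : (m <= n)%N -> @finsum R k E m `<=` finsum n.
Proof. by move=> mn c cm l nl; rewrite cm // (leq_trans mn). Qed.

Lemma V_le m n : (m <= n)%N -> V S m `<=` V S n.
Proof.
move=> mn _ [c cm <-]; exists c; first exact: (finsum_le mn cm).
by rewrite (SfinE cm).
Qed.

Lemma subspace_V m : subspace (V S m).
Proof.
split; first by exists 0; rewrite ?/Sfin ?big1 // => l _; exact: linear0.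
move=> a _ _ [c cm <-] [d dm <-]; exists (a *: c + d); last exact: Sfin_linear.
by case: (subspace_finsum E m) => _; apply.
Qed.

Lemma closed_V m : closed (V S m).
Proof.
case: m => [|m]; last exact: V_closed.
(* [V_closed] starts at 1; [V S 0] is a single point, closed since the space is Hausdorff. *)
rewrite (_ : V S 0 = [set 0]).
  apply: accessible_closed_set1.
  exact: (hausdorff_accessible (@norm_hausdorff _ _)).
apply/seteqP; split=> [_ [c _ <-]|_ ->]; first by rewrite Sfin0.
by exists 0; rewrite ?Sfin0.
Qed.

Arguments closed_V : clear implicits.

Lemma P_spec m f : V S m (P S m f) /\ forall w, V S m w -> inner (f - P S m f) w = 0.
Proof. exact: (orth_projP (subspace_V m) (closed_V m) f). Qed.

Lemma V_S l (x : E l) : V S l.+1 (S l x).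
Proof.
(* The family supported on level [l] alone; as levels start at 0, it lies in [finsum l.+1]. *)
exists (dfwith (fzero : fam E) l x) => [j lj|].
  by rewrite dfwithout // neq_ltn lj.
rewrite /Sfin big_ord_recr /= dfwithin big1 ?add0r // => -[j /= jl] _.
by rewrite dfwithout ?linear0 // gtn_eqF.
Qed.

Lemma S_bound l : exists b, forall x, nrm (S l x) <= b * nrm x.
Proof.
have [b hb] := opnorm_fin (S_bounded l).
exists b => x; apply: (opnorm_bound (sc := fun r x => ofR r *: x) _ _ _ hb) => //.
- by move=> r y r0 _; split=> //; rewrite ?linearZ /= nrmZR ?ltW.
- exact: nrm_ge0.
- exact: nrm_ge0.
Qed.

Lemma S_sqn_bound l :
  exists2 b, 0 <= b & forall x, nrm (S l x) ^+ 2 <= b * nrm x ^+ 2.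
Proof.
have [b hb] := S_bound l; exists (b ^+ 2) => [|x]; first exact: sqr_ge0.
have h := hb x; have n0 := nrm_ge0 (S l x).
by rewrite -exprMn ler_sqr ?nnegrE // (le_trans n0 h).
Qed.

Lemma Sfin_bounded m : bounded_linear (dotn m) inner (finsum m) (Sfin S m).
Proof.
split=> [a x y _ _|]; first exact: Sfin_linear.
suff [b b0 hb] : exists2 b, 0 <= b &
    forall c, sqn inner (Sfin S m c) <= b * sqn (@dotn R k E m) c.
  by exists b => c _.
elim: m => [|m [b b0 hb]].
  by exists 0 => // c; rewrite Sfin0 sqn_inner nrm0 mul0r expr0n.
have [b' b'0 hb'] := S_sqn_bound m.
(* The factors 2 come from [|u + v|^2 <= 2 |u|^2 + 2 |v|^2]. *)
exists (2 * b + 2 * b') => [|c]; first by rewrite addr_ge0 ?mulr_ge0.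
rewrite /Sfin big_ord_recr /= sqn_dotn big_ord_recr /= -sqn_dotn.
have := hb c; rewrite /Sfin; have := hb' (c m); rewrite -sqn_inner.
move: (\sum_(l < m) S l (c l)) (S m (c m)) => u v hv hu.
have : sqn inner (u + v) <= 2 * sqn inner u + 2 * sqn inner v.
  have := sqn_ge0 HI (u - v); rewrite (sqnB HI) (sqnD HI) => h; lra.
have := sqr_ge0 (nrm (c m)); have := sqn_ge0 (dotn_semi E m) c.
move: (sqn _ _) (_ ^+ 2) hu hv => p q; nra.
Qed.

Lemma Rop_linear l a (x y : E l) : Rop S (a *: x + y) = a *: Rop S x + Rop S y.
Proof.
rewrite /Rop linearP /P (orth_proj_linear (subspace_V l) (closed_V l)).
by rewrite scalerBr opprD addrACA.
Qed.

Lemma Rop_bounded l : bounded_linear inner inner setT (@Rop R k H E S l).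
Proof.
split=> [a x y _ _|]; first exact: Rop_linear.
have [b _ hb] := S_sqn_bound l; exists b => x _; rewrite !sqn_inner.
apply: le_trans (hb x); exact: (nrm_sub_orth_proj_le (subspace_V l) (closed_V l) _).
Qed.

(** [D] is the adjoint of [Rop] composed with [Rop]; bounds on [D] thus become bounds on [Rop]. *)
Lemma re_D l (x : E l) : re (inner (D S x) x) = nrm (Rop S x) ^+ 2.
Proof.
have [_ h] := adjointP (inner_semi (E l)) HI 0 (Rop S x) (X := setT)
  (ltac:(by [])) (closed_complete_in closedT) (Rop_bounded l).
by rewrite (re_dotC (inner_semi _)) -(h x I) -sqn_inner.
Qed.

Lemma V_Rop l (x : E l) : V S l.+1 (Rop S x).
Proof.
apply: subspaceB (subspace_V _) (V_S x) _.
exact: (V_le (leqnSn l) (P_spec l _).1).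
Qed.

Lemma inner_Rop l (x : E l) w : V S l w -> inner (Rop S x) w = 0.
Proof. exact: (P_spec l _).2. Qed.

Lemma V_sum_Rop m (x : fam E) : V S m (\sum_(l < m) Rop S (x l)).
Proof.
elim: m => [|m IH]; first by rewrite big_ord0; case: (subspace_V 0).
rewrite big_ord_recr /=; apply: subspaceD (subspace_V _) _ (V_Rop _).
exact: (V_le (leqnSn m) IH).
Qed.

(** Pythagoras by induction: the last term is orthogonal to [V S m], which contains the sum of the
    earlier ones. *)
Lemma nrm_sum_Rop m (x : fam E) :
  nrm (\sum_(l < m) Rop S (x l)) ^+ 2 = \sum_(l < m) nrm (Rop S (x l)) ^+ 2.
Proof.
elim: m => [|m IH]; first by rewrite !big_ord0 nrm0 expr0n.
rewrite !big_ord_recr /= -IH -!sqn_inner -(sqnD_orth HI) //.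
by apply: (orth_sym HI); apply: inner_Rop; exact: V_sum_Rop.
Qed.

End Levels.
Arguments closed_V {R k H E S} V_closed m.

(** * The norm [fnorm] and its relation to [dotn] *)

Section Norms.
Context (R : realType) (k : scalar_kind) (E : nat -> hilbertType R k).
Local Notation fam := (fam E).
Implicit Types (c d x y : fam) (m : nat).

Lemma sqr_fnorm m c : finsum m c -> fnorm c ^+ 2 = sqn (dotn m) c.
Proof.
by move=> cm; rewrite (fnormE cm) sqr_sqrtr // sqn_ge0 //; exact: dotn_semi.
Qed.

Lemma fsq_ge0 c : (0 <= fsq c)%E.
Proof. by apply: nneseries_ge0 => l _ _; rewrite lee_fin sqr_ge0. Qed.

Lemma fsqZR (r : R) c : 0 <= r -> fsq (ofR r *: c) = ((r ^+ 2)%:E * fsq c)%E.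
Proof.
move=> r0; rewrite /fsq -nneseriesZl; last by move=> l _; rewrite lee_fin sqr_ge0.
apply: eq_eseriesr => l _.
by rewrite [in LHS](_ : _ l = ofR r *: c l) // nrmZR // exprMn EFinM.
Qed.

Lemma l2sumZR (r : R) c : 0 <= r -> l2sum c -> l2sum (ofR r *: c).
Proof.
by move=> r0 hc; rewrite /l2sum /= fsqZR // lte_mul_pinfty ?lee_fin ?sqr_ge0.
Qed.

Lemma fnormZR (r : R) c : 0 <= r -> l2sum c -> fnorm (ofR r *: c) = r * fnorm c.
Proof.
move=> r0 hc; rewrite /fnorm fsqZR // fineM //; last first.
  by rewrite ge0_fin_numE ?fsq_ge0.
by rewrite sqrtrM ?sqr_ge0 // sqrtr_sqr ger0_norm.
Qed.

Lemma fnorm0 : fnorm (0 : fam) = 0.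
Proof.
have h : finsum 0 (0 : fam) by move=> l _.
by rewrite (fnormE h) sqn_dotn big_ord0 sqrtr0.
Qed.

Lemma re_dotn_le m x y : finsum m x -> finsum m y ->
  re (dotn m x y) <= fnorm x * fnorm y.
Proof.
move=> xm ym; rewrite (le_trans (ler_norm _)) //.
rewrite -ler_sqr ?nnegrE ?normr_ge0 ?mulr_ge0 ?fnorm_ge0 //.
rewrite real_normK ?num_real // exprMn (sqr_fnorm xm) (sqr_fnorm ym).
exact: (cauchy_schwarz (dotn_semi E m)).
Qed.

Lemma bounded_linear_fam m (X : set fam) (f : fam -> fam) :
  subspace X -> X `<=` finsum m -> (forall x, X x -> finsum m (f x)) ->
  (forall a x y, X x -> X y -> f (a *: x + y) = a *: f x + f y) ->
  (opnorm fnorm fnorm X f < +oo)%E -> bounded_linear (dotn m) (dotn m) X f.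
Proof.
move=> subX Xm fm fL /opnorm_fin[b hb]; split=> //; exists (b ^+ 2) => x Xx.
have f0 : f 0 = 0.
  have [X0 _] := subX; have := fL 1 0 0 X0 X0.
  by rewrite !scale1r addr0 => /eqP; rewrite -subr_eq0 opprD addrA subrr sub0r
    oppr_eq0 => /eqP.
have fZ a y : X y -> f (a *: y) = a *: f y.
  by move=> Xy; have [X0 _] := subX; rewrite -[_ *: y]addr0 fL // f0 addr0.
have h : fnorm (f x) <= b * fnorm x.
  apply: (opnorm_bound (sc := fun r (y : fam) => ofR r *: y) _ _ _ hb) => //.
  - move=> r y r0 Xy; split; first exact: subspaceZ.
      by apply: fnormZR (ltW r0) _; exact: (finsum_l2sum (Xm _ Xy)).
    rewrite fZ //; apply: fnormZR (ltW r0) _.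
    exact: (finsum_l2sum (fm _ Xy)).
  - exact: fnorm_ge0.
  - exact: fnorm_ge0.
have n0 := fnorm_ge0 (f x).
rewrite -(sqr_fnorm (fm _ Xx)) -(sqr_fnorm (Xm _ Xx)) -exprMn.
by rewrite ler_sqr ?nnegrE // (le_trans n0 h).
Qed.

End Norms.

(** * Quotient spaces, the coordinate isomorphism and its adjoint *)

Section Frame.
Context (R : realType) (k : scalar_kind) (H : hilbertType R k)
  (E : nat -> hilbertType R k) (S : forall l, {linear E l -> H}).
Hypotheses (S_bounded : forall l, bounded_operator (S l))
  (V_closed : forall m, (0 < m)%N -> closed (V S m)).
Implicit Types (m : nat) (x y z c : fam E).

Lemma quotSE m :
  quotS S m = quot (dotn m) (finsum m) [set z | finsum m z /\ Sfin S m z = 0].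
Proof.
apply/seteqP; split=> x [xm hx]; split=> // z hz.
  by rewrite -(fdotE _ xm); exact: hx.
by rewrite (fdotE _ xm); exact: hx.
Qed.

Lemma subspace_quotS m : subspace (quotS S m).
Proof.
rewrite quotSE.
exact: (subspace_quot (dotn_semi E m) _ (subspace_finsum E m)).
Qed.

Lemma complete_in_quotS m : complete_in (dotn m) (quotS S m).
Proof.
rewrite quotSE; exact: (complete_in_quot (dotn_semi E m) (subspace_finsum E m)
  (complete_in_finsum m)).
Qed.

Arguments complete_in_quotS : clear implicits.

Lemma dotn_dfwith m l y (z : E l) : (l < m)%N ->
  dotn m y (dfwith (0 : fam E) l z) = inner (y l) z.
Proof.
move=> lm; rewrite /dotn (bigD1 (Ordinal lm)) //= dfwithin big1 ?addr0 // => i il.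
rewrite dfwithout ?(dot0r (inner_semi _)) // eq_sym; exact: il.
Qed.

(** Presents the sum of the level quotients as one orthogonal complement, so that its linearity and
    completeness follow from the general results on [quot]. *)
Lemma quotEsumE m :
  quotEsum S m = quot (dotn m) (finsum m)
    [set x | exists l (z : E l),
      [/\ (l < m)%N, D S z = 0 & x = dfwith (0 : fam E) l z]].
Proof.
apply/seteqP; split=> y [ym hy]; split=> //.
  by move=> _ [l [z [lm Dz ->]]]; rewrite dotn_dfwith //; exact: (hy l lm).2.
move=> l lm; split=> // z Dz; rewrite -(dotn_dfwith _ _ lm).
by apply: hy; exists l, z.
Qed.

Lemma subspace_quotEsum m : subspace (quotEsum S m).
Proof.
rewrite quotEsumE.
exact: (subspace_quot (dotn_semi E m) _ (subspace_finsum E m)).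
Qed.

Lemma complete_in_quotEsum m : complete_in (dotn m) (quotEsum S m).
Proof.
rewrite quotEsumE; exact: (complete_in_quot (dotn_semi E m) (subspace_finsum E m)
  (complete_in_finsum m)).
Qed.

Arguments complete_in_quotEsum : clear implicits.

(** [p] is [c] minus its projection onto the kernel of [Sfin S m], which is complete: the
    minimum-norm representative of the class of [c]. *)
Lemma quotS_decomposition m c : finsum m c ->
  exists p, [/\ quotS S m p, Sfin S m p = Sfin S m c & fnorm p <= fnorm c].
Proof.
move=> cm; have dP := dotn_semi E m; have subF := subspace_finsum E m.
pose N := [set z : fam E | finsum m z /\ Sfin S m z = 0].
have S0 : Sfin S m 0 = 0 by rewrite /Sfin big1 // => l _; exact: linear0.
have subN : subspace N.
  split=> [|a x y [xm hx] [ym hy]]; first by split=> //; case: subF.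
  split; first by case: subF => _; apply.
  by rewrite Sfin_linear hx hy scaler0 addr0.
have compN : complete_in (dotn m) N.
  exact: (complete_in_ker dP subF (complete_in_finsum m) (Sfin_bounded S_bounded m)).
have [z [[zm hz] cz]] := projection_exists dP c subN compN.
have pm : finsum m (c - z) := subspaceB subF cm zm.
exists (c - z); split.
- by rewrite quotSE.
- by rewrite addrC -scaleN1r Sfin_linear hz scaler0 add0r.
- rewrite -ler_sqr ?nnegrE ?fnorm_ge0 // (sqr_fnorm pm) (sqr_fnorm cm).
  rewrite -[in leRHS](subrK z c) (sqnD_orth dP (x := c - z)); last by apply: cz.
  by rewrite lerDl (sqn_ge0 dP).
Qed.

Section Coordinates.
Context (m : nat) (C : fam E -> fam E).
Hypothesis C_iso : is_coordinate_iso S m C.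
Let d := @dotn R k E m.
Let dP : semi_inner d := dotn_semi E m.

Lemma quotS_finsum : quotS S m `<=` finsum m. Proof. by move=> x []. Qed.

Lemma quotEsum_finsum : quotEsum S m `<=` finsum m. Proof. by move=> x []. Qed.

Lemma C_quotEsum x : quotS S m x -> quotEsum S m (C x).
Proof. by case: C_iso => -[h _ _] _ _ _ _ Xx; apply: h. Qed.

Lemma C_bounded : bounded_linear d d (quotS S m) C.
Proof.
case: C_iso => _ CL Cb _ _; apply: bounded_linear_fam => //.
- exact: subspace_quotS.
- exact: quotS_finsum.
- by move=> x /C_quotEsum []. 
Qed.

Lemma L_adjoint y :
  quotS S m (L S m C y) /\ forall z, quotS S m z -> d (C z) y = d z (L S m C y).
Proof.
(* [L] is defined through [fdot]; the predicate given to [xget] is the same set when written with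
   [dotn m]. *)
have -> : L S m C y = adjoint d d (quotS S m) fzero C y.
  rewrite /L /adjoint; congr xget; apply/seteqP; split=> x [Xx hx]; split=> // z Xz.
    have := hx z Xz; rewrite (fdotE _ (quotS_finsum Xz)).
    by rewrite (fdotE _ (quotEsum_finsum (C_quotEsum Xz))).
  rewrite (fdotE _ (quotS_finsum Xz)) (fdotE _ (quotEsum_finsum (C_quotEsum Xz))).
  exact: hx.
apply: (adjointP dP dP fzero y (subspace_quotS m)) C_bounded.
exact: complete_in_quotS.
Qed.

(** With [G] the inverse of [C], the preimage is [G^* u], because [L G^* = (G C)^* = I]. *)
Lemma L_surj u : quotS S m u -> exists2 y, quotEsum S m y & L S m C y = u.
Proof.
move=> Xu; have [[CXY Cinj Csurj] CL _ Cinvb _] := C_iso.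
set G := 'pinv_(fun=> fzero) (quotS S m) C in Cinvb.
have GX y : quotEsum S m y -> quotS S m (G y).
  by move=> Yy; apply: (surjpinv_image_sub Csurj); exists y.
have CG y : quotEsum S m y -> C (G y) = y.
  by move=> Yy; apply: (surjpK _ Csurj); rewrite inE.
have GC x : quotS S m x -> G (C x) = x.
  by move=> Xx; apply: pinvKV => //; rewrite inE.
have [subX subY] := (subspace_quotS m, subspace_quotEsum m).
have Gb : bounded_linear d d (quotEsum S m) G.
  apply: bounded_linear_fam => //.
  - exact: quotEsum_finsum.
  - by move=> y /GX /quotS_finsum.
  - move=> a x y Yx Yy.
    have Xc : quotS S m (a *: G x + G y) by case: subX => _; apply; exact: GX.
    rewrite -[RHS](GC _ Xc) -flinE CL; [|exact: GX|exact: GX].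
    by rewrite !CG.
have [Yy hy] := adjointP dP dP fzero u subY (complete_in_quotEsum m) Gb.
set y := adjoint _ _ _ _ _ _ in Yy hy.
exists y => //; have [XL hL] := L_adjoint y.
have Xd : quotS S m (L S m C y - u) := subspaceB subX XL Xu.
apply/eqP; rewrite -subr_eq0; apply/eqP.
apply: (dotn_definite (quotS_finsum Xd)).
(* For [v = L y - u]: [<v, L y> = <C v, y> = <G (C v), u> = <v, u>], so [v] has norm zero. *)
by rewrite /sqn (re_dotBr dP) -/d -hL // -(hy _ (C_quotEsum Xd)) GC // subrr.
Qed.

(* Test the adjoint on the unit vector [C x / |C x|]:
   [|C x| = <C x, y> = <x, L y> <= M |x|]. *)
Lemma C_le (M : R) x : (norm_L S m C <= M%:E)%E -> quotS S m x ->
  fnorm (C x) <= M * fnorm x.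
Proof.
move=> LM Xx; have Yx := C_quotEsum Xx.
have M0 : 0 <= M.
  have [Y0 _] := subspace_quotEsum m.
  by apply: le_trans (fnorm_ge0 _) (opnorm_ge LM Y0 _); rewrite fnorm0.
have [->|n0] := eqVneq (fnorm (C x)) 0; first by rewrite mulr_ge0 ?fnorm_ge0.
pose r := (fnorm (C x))^-1; have r0 : 0 <= r by rewrite invr_ge0 fnorm_ge0.
have Yy : quotEsum S m (ofR r *: C x) := subspaceZ _ (subspace_quotEsum m) Yx.
have [XL hL] := L_adjoint (ofR r *: C x).
have ny : fnorm (ofR r *: C x) <= 1.
  by rewrite fnormZR ?mulVf //; exact: (finsum_l2sum (quotEsum_finsum Yx)).
have := opnorm_ge LM Yy ny; move: (L S m C _) XL hL => w Xw hw nw.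
have := re_dotn_le (quotS_finsum Xx) (quotS_finsum Xw).
rewrite -/d -hw // (dotZr dP) sconj_ofR reM -/(sqn d _).
rewrite -(sqr_fnorm (quotEsum_finsum Yx)) expr2 mulrA mulVf // mul1r => h.
by rewrite (le_trans h) // mulrC ler_wpM2r ?fnorm_ge0.
Qed.

(* With [y = L^-1 (x / |x|)]: [|x| = <x, L y> = <C x, y> <= K |C x|]. *)
Lemma C_ge (K : R) x : (norm_Linv S m C <= K%:E)%E -> quotS S m x ->
  fnorm x <= K * fnorm (C x).
Proof.
move=> LK Xx; have Yx := C_quotEsum Xx.
have K0 : 0 <= K.
  have [X0 _] := subspace_quotS m.
  by apply: le_trans (fnorm_ge0 _) (opnorm_ge LK X0 _); rewrite fnorm0.
have [->|n0] := eqVneq (fnorm x) 0; first by rewrite mulr_ge0 ?fnorm_ge0.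
pose r := (fnorm x)^-1; have r0 : 0 <= r by rewrite invr_ge0 fnorm_ge0.
have Xu : quotS S m (ofR r *: x) := subspaceZ _ (subspace_quotS m) Xx.
(* Surjectivity makes [Linv] a right inverse of [L] with values in [quotEsum S m]. *)
have Lsurj : set_surj (quotEsum S m) (quotS S m) (L S m C).
  by move=> u /L_surj[y Yy Ly]; exists y.
have nu : fnorm (ofR r *: x) <= 1.
  by rewrite fnormZR ?mulVf //; exact: (finsum_l2sum (quotS_finsum Xx)).
have nw := opnorm_ge LK Xu nu.
have Yw : quotEsum S m (Linv S m C (ofR r *: x)).
  by apply: (surjpinv_image_sub Lsurj); exists (ofR r *: x).
have Lw : L S m C (Linv S m C (ofR r *: x)) = ofR r *: x.
  by apply: (surjpK _ Lsurj); rewrite inE.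
move: (Linv S m C _) nw Yw Lw => w nw Yw Lw.
have [_ /(_ x Xx)] := L_adjoint w; rewrite Lw => hw.
have := re_dotn_le (quotEsum_finsum Yx) (quotEsum_finsum Yw).
rewrite -/d hw (dotZr dP) sconj_ofR reM -/(sqn d _).
rewrite -(sqr_fnorm (quotS_finsum Xx)) expr2 mulrA mulVf // mul1r => h.
by rewrite (le_trans h) // mulrC ler_wpM2r ?fnorm_ge0.
Qed.

End Coordinates.

End Frame.

(** * The frame inequalities at a finite level *)

Section FrameBounds.
Context (R : realType) (k : scalar_kind) (H : hilbertType R k)
  (E : nat -> hilbertType R k) (S : forall l, {linear E l -> H}).
Hypotheses (S_bounded : forall l, bounded_operator (S l))
  (V_closed : forall m, (0 < m)%N -> closed (V S m)).
Context (delta Delta : R) (delta_ge0 : 0 <= delta) (Delta_ge0 : 0 <= Delta).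
Hypothesis D_bounds : forall l (x : E l), quotE S x ->
  delta * nrm x ^+ 2 <= re (inner (D S x) x) <= Delta * nrm x ^+ 2.

Lemma nrm_Sfin_bounds m C x : is_coordinate_iso S m C -> quotS S m x ->
  delta * fnorm (C x) ^+ 2 <= nrm (Sfin S m x) ^+ 2 <= Delta * fnorm (C x) ^+ 2.
Proof.
move=> C_iso Xx; have [ym hy] := C_quotEsum C_iso Xx.
have [_ _ _ _ ->] := C_iso => //.
rewrite (nrm_sum_Rop V_closed) (sqr_fnorm ym) sqn_dotn !mulr_sumr.
have h l (lm : (l < m)%N) := D_bounds (hy l lm).
by apply/andP; split; apply: ler_sum => l _; have := h l (ltn_ord l);
  rewrite (re_D S_bounded V_closed) => /andP[].
Qed.

(** Multiplied through by [K ^+ 2], so that [K = 0] is included. *)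
Lemma frame_lower m C (K : R) x :
  is_coordinate_iso S m C -> (norm_Linv S m C <= K%:E)%E -> quotS S m x ->
  delta * fnorm x ^+ 2 <= K ^+ 2 * nrm (Sfin S m x) ^+ 2.
Proof.
move=> C_iso LK Xx; have /andP[h _] := nrm_Sfin_bounds C_iso Xx.
have n0 := fnorm_ge0 x; have hx := C_ge C_iso LK Xx.
have {hx} : fnorm x ^+ 2 <= K ^+ 2 * fnorm (C x) ^+ 2.
  by rewrite -exprMn ler_sqr ?nnegrE // (le_trans n0).
move=> /(ler_wpM2l delta_ge0)/le_trans; apply.
by rewrite mulrCA ler_wpM2l ?sqr_ge0.
Qed.

(** Extends from [quotS S m] to [finsum m] by passing to the minimum-norm representative, which has
    the same image and no larger norm. *)
Lemma frame_upper m C (M : R) c :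
  is_coordinate_iso S m C -> (norm_L S m C <= M%:E)%E -> finsum m c ->
  nrm (Sfin S m c) <= Num.sqrt (Delta * M ^+ 2) * fnorm c.
Proof.
move=> C_iso LM cm; have [p [Xp <- pc]] := quotS_decomposition S_bounded cm.
have /andP[_ h] := nrm_Sfin_bounds C_iso Xp.
have n0 := fnorm_ge0 (C p); have hp := C_le C_iso LM Xp.
have p0 := fnorm_ge0 p; have c0 := fnorm_ge0 c.
have B0 : 0 <= Delta * M ^+ 2 by rewrite mulr_ge0 ?sqr_ge0.
rewrite -ler_sqr ?nnegrE ?mulr_ge0 ?sqrtr_ge0 ?nrm_ge0 //.
rewrite exprMn sqr_sqrtr // (le_trans h) // -mulrA ler_wpM2l //.
apply: (@le_trans _ _ (M ^+ 2 * fnorm p ^+ 2)).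
  by rewrite -exprMn ler_sqr ?nnegrE // (le_trans n0).
by rewrite ler_wpM2l ?sqr_ge0 // ler_sqr ?nnegrE.
Qed.

End FrameBounds.

(** * Square-summable families and the extension of the synthesis maps *)

Section Extension.
Context (R : realType) (k : scalar_kind) (H : hilbertType R k)
  (E : nat -> hilbertType R k) (S : forall l, {linear E l -> H}).
Implicit Types (c d : fam E).

Lemma l2sum_sub c d : l2sum c -> l2sum d -> l2sum (c - d).
Proof.
move=> hc hd; rewrite /l2sum /=.
(* Termwise parallelogram inequality [|x - y|^2 <= 2 |x|^2 + 2 |y|^2]. *)
apply: (@le_lt_trans _ _ (2%:E * fsq c + 2%:E * fsq d)%E); last first.
  by rewrite lte_add_pinfty // lte_mul_pinfty // ?lee_fin // ltry.
have sq0 (F : fam E) l : (0 <= (nrm (F l) ^+ 2)%:E)%E by rewrite lee_fin sqr_ge0.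
rewrite /fsq -!nneseriesZl // -nneseriesD //; try by move=> l *; exact: mule_ge0.
apply: lee_nneseries => // l _; rewrite -!EFinM -EFinD lee_fin -!sqn_inner.
rewrite [in leLHS](_ : (c - d) l = c l - d l) //.
have := sqn_ge0 (inner_semi (E l)) (c l + d l).
by rewrite (sqnB (inner_semi _)) (sqnD (inner_semi _)); lra.
Qed.

Lemma ftrunc_finsum m c : finsum m (ftrunc m c).
Proof. by move=> l ml; rewrite /ftrunc ltnNge ml. Qed.

Arguments ftrunc_finsum : clear implicits.

Lemma fsq_ftrunc m c : fsq c = (fsq (ftrunc m c) + fsq (c - ftrunc m c)%R)%E.
Proof.
have sq0 (F : fam E) l : (0 <= (nrm (F l) ^+ 2)%:E)%E by rewrite lee_fin sqr_ge0.
rewrite /fsq -nneseriesD //; apply: eq_eseriesr => l _.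
rewrite [in RHS](_ : (c - ftrunc m c) l = c l - ftrunc m c l) // /ftrunc.
by case: ifP => _; rewrite ?subrr ?subr0 nrm0 expr0n ?adde0 ?add0e.
Qed.

Lemma fnorm_ftrunc_le m c : l2sum c -> fnorm (ftrunc m c) <= fnorm c.
Proof.
move=> hc; rewrite /fnorm ler_wsqrtr // fine_le ?ge0_fin_numE ?fsq_ge0 //.
  exact: (finsum_l2sum (ftrunc_finsum m c)).
by rewrite [leRHS](fsq_ftrunc m) leeDl ?fsq_ge0.
Qed.

Lemma fnorm_tail_small c (e : R) : l2sum c -> 0 < e ->
  exists m, fnorm (c - ftrunc m c) <= e.
Proof.
move=> hc e0; have cfin : fsq c \is a fin_num by rewrite ge0_fin_numE ?fsq_ge0.
have /fine_cvgP[_ /cvgrPdist_lt/(_ _ (exprn_gt0 2 e0))[m _ hm]] :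
    (fun n => \sum_(0 <= l < n) (nrm (c l) ^+ 2)%:E)%E @ \oo --> (fine (fsq c))%:E.
  by rewrite fineK //; apply: is_cvg_nneseries => l _ _; rewrite lee_fin sqr_ge0.
exists m; have := hm m (leqnn m); rewrite /= => {}hm.
have tm := ftrunc_finsum m c.
have tfin : fsq (ftrunc m c) \is a fin_num by rewrite (fsqE tm).
have dfin : fsq (c - ftrunc m c) \is a fin_num.
  by rewrite ge0_fin_numE ?fsq_ge0 //; exact: (l2sum_sub hc (finsum_l2sum tm)).
rewrite /fnorm -[leRHS]ger0_norm ?(ltW e0) // -sqrtr_sqr ler_wsqrtr //.
have -> : fine (fsq (c - ftrunc m c)) = fine (fsq c) - fine (fsq (ftrunc m c)).
  by rewrite [in RHS](fsq_ftrunc m c) fineD // addrAC subrr add0r.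
rewrite (le_trans (ler_norm _)) // ltW //; move: hm; congr (`|_ - _| < _).
rewrite (fsqE tm) sqn_dotn /= sumEFin /= big_mkord.
by apply: eq_bigr => l _; rewrite /ftrunc ltn_ord.
Qed.

(* Without a bounded extension, [Sinf] is the default value of [xget], the zero
   map, and the bound is trivial. *)
Lemma Sinf_sub_le (b : R) c d : 0 <= b ->
  (forall m x, finsum m x -> nrm (Sfin S m x) <= b * fnorm x) ->
  l2sum c -> l2sum d -> nrm (Sinf S c - Sinf S d) <= b * fnorm (c - d).
Proof.
move=> b0 hb hc hd.
have [extS|noext] := pselect (exists T, is_extension S T); last first.
  have -> : Sinf S = fun=> 0.
    rewrite /Sinf; case: xgetP => // T _ hT; case: noext; by exists T.
  by rewrite subrr nrm0 mulr_ge0 ?fnorm_ge0.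
have : is_extension S (Sinf S) by exact: xgetPex.
move: (Sinf S) => T [TL /opnorm_fin[b' hb'] Tfin].
have TB x y : l2sum x -> l2sum y -> T (x - y) = T x - T y.
  by move=> hx hy; rewrite addrC -scaleN1r -flinE TL // scaleN1r addrC.
rewrite -TB //; have := l2sum_sub hc hd; move: (c - d) => x hx {c d hc hd}.
have T0 : T 0 = 0.
  by rewrite (Tfin 0%N) ?/Sfin ?big_ord0.
have Tb y : l2sum y -> nrm (T y) <= b' * fnorm y.
  apply: (opnorm_bound (sc := fun r (z : fam E) => ofR r *: z) _ _ _ hb') => //.
  - move=> r z r0 hz; split.
    + exact: l2sumZR (ltW r0) hz.
    + exact: fnormZR (ltW r0) hz.
    have h0 : @l2sum R k E 0 by apply: (@finsum_l2sum _ _ _ 0).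
    by rewrite -[ofR r *: z]addr0 -flinE TL // T0 addr0 nrmZR // ltW.
  - exact: fnorm_ge0.
  - exact: nrm_ge0.
apply/ler_addgt0Pr => e e0.
(* The extension's own bound [b'] is spent on a small tail only; the truncation obeys [b], so [b']
   disappears as [e] tends to 0. *)
have b1 : 0 < `|b'| + 1 by rewrite ltr_wpDl.
have [m hm] := fnorm_tail_small hx (divr_gt0 e0 b1).
have tm := ftrunc_finsum m x; have ht := finsum_l2sum tm.
have hd := l2sum_sub hx ht.
have -> : T x = T (ftrunc m x) + T (x - ftrunc m x) by rewrite TB // addrC subrK.
rewrite (le_trans (ler_nrmD _ _)) // lerD //.
  by rewrite (Tfin _ _ tm) (le_trans (hb _ _ tm)) // ler_wpM2l ?fnorm_ftrunc_le.
rewrite (le_trans (Tb _ hd)) //.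
rewrite (@le_trans _ _ (`|b'| * fnorm (x - ftrunc m x))) //.
  by rewrite ler_wpM2r ?fnorm_ge0 ?ler_norm.
rewrite ler_pdivlMr // in hm; rewrite (le_trans _ hm) // mulrC.
by rewrite ler_wpM2l ?fnorm_ge0 // lerDl ler01.
Qed.

End Extension.

(** * Closures of subspaces *)

Section Closure.
Context (R : realType) (k : scalar_kind) (H : hilbertType R k).
Implicit Types (A : set H) (x y : H).

Lemma closure_nrmP A x :
  closure A x <-> forall e : R, 0 < e -> exists2 v, A v & nrm (x - v) < e.
Proof.
split=> [Ax e e0|h B /nbhs_ballP[e /= e0 eB]].
  have e1 : 0 < ofR e :> scalar_field R k by rewrite -(ofR0 R k) lt_ofR.
  have [v [Av]] := Ax _ (nbhsx_ballx x (ofR e) e1).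
  by rewrite -ball_normE /= -ofR_nrm lt_ofR => hv; exists v.
have e1 : 0 < re e by rewrite -(lt_ofR k) ofR0 ofR_re // ltW.
have [v Av hv] := h _ e1; exists v; split=> //; apply: eB.
by rewrite -ball_normE /= -ofR_nrm -(ofR_re (ltW e0)) lt_ofR.
Qed.

Lemma nrmZ a x : nrm (a *: x) = re `|a| * nrm x.
Proof. by rewrite /nrm normrZ -{1}(ofR_re (normr_ge0 a)) reM. Qed.

Lemma subspace_closure A : subspace A -> subspace (closure A).
Proof.
move=> subA; split; first by apply: subset_closure; case: subA.
move=> a x y /closure_nrmP Ax /closure_nrmP Ay; apply/closure_nrmP => e e0.
have a0 : 0 <= re `|a| by rewrite -(le_ofR k) ofR0 ofR_re.
have a1 : 0 < re `|a| + 1 by rewrite ltr_wpDl.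
have e2 : 0 < e / 2 by rewrite divr_gt0.
have [v Av hv] := Ax _ (divr_gt0 e2 a1); have [w Aw hw] := Ay _ e2.
exists (a *: v + w); first by case: subA => _; apply.
have -> : a *: x + y - (a *: v + w) = a *: (x - v) + (y - w).
  by rewrite scalerBr opprD addrACA.
rewrite (le_lt_trans (ler_nrmD _ _)) // [ltRHS](splitr e) ler_ltD // nrmZ.
rewrite ltr_pdivlMr // in hv; rewrite (le_trans _ (ltW hv)) // mulrC.
by rewrite ler_wpM2l ?nrm_ge0 // lerDl ler01.
Qed.

End Closure.

(** * Convergence of the projections and the error identity *)

Section Approximation.
Context (R : realType) (k : scalar_kind) (H : hilbertType R k)
  (E : nat -> hilbertType R k) (S : forall l, {linear E l -> H}).
Hypothesis V_closed : forall m, (0 < m)%N -> closed (V S m).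
Implicit Types f : H.

Lemma subspace_bigcup_V : subspace (\bigcup_m V S m).
Proof.
split; first by exists 0%N => //; case: (subspace_V S 0).
move=> a x y [i _ Vx] [j _ Vy]; exists (maxn i j) => //.
have [_ VL] := subspace_V S (maxn i j).
by apply: VL; [exact: (V_le (leq_maxl i j) Vx)|exact: (V_le (leq_maxr i j) Vy)].
Qed.

Lemma V_Vinf m x : V S m x -> Vinf S x.
Proof. by move=> Vx; apply: subset_closure; exists m. Qed.

Lemma PV_pythagoras f w : Vinf S w ->
  nrm (f - w) ^+ 2 = nrm (f - PV S f) ^+ 2 + nrm (PV S f - w) ^+ 2.
Proof.
apply: orth_proj_pythagoras; last exact: closed_closure.
exact: subspace_closure subspace_bigcup_V.
Qed.

Lemma P_pythagoras m f w : V S m w ->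
  nrm (f - w) ^+ 2 = nrm (f - P S m f) ^+ 2 + nrm (P S m f - w) ^+ 2.
Proof.
by apply: orth_proj_pythagoras; [exact: subspace_V|exact: (closed_V V_closed m)].
Qed.

Lemma P_V m f : V S m (P S m f).
Proof. exact: (P_spec V_closed m f).1. Qed.

(** Some [v] in some [V S N] is close to [PV S f]. For [n >= N], [P S n f] is at least as close to
    [f] as [v], and by Pythagoras through [PV S f] also at least as close to [PV S f]. *)
Lemma nrm_PV_P_small f (e : R) : 0 < e ->
  exists N, forall n, (N <= n)%N -> nrm (PV S f - P S n f) ^+ 2 < e.
Proof.
move=> e0; have s0 : 0 < Num.sqrt e by rewrite sqrtr_gt0.
have subVinf := subspace_closure subspace_bigcup_V.
have [/closure_nrmP/(_ _ s0)[v [N _ Vv] hv] _] :=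
  orth_projP subVinf (@closed_closure _ _) f.
exists N => n Nn; have Vnv : V S n v := V_le Nn Vv.
apply: (@le_lt_trans _ _ (nrm (PV S f - v) ^+ 2)); last first.
  by rewrite -[ltRHS]sqr_sqrtr ?(ltW e0) // ltr_sqr ?nnegrE ?nrm_ge0 ?ltW.
have := PV_pythagoras f (V_Vinf Vnv); have := PV_pythagoras f (V_Vinf (P_V n f)).
have := P_pythagoras f Vnv; have := sqr_ge0 (nrm (P S n f - v)).
by lra.
Qed.

Lemma P_cvg f : P S m f @[m --> \oo] --> PV S f.
Proof.
apply/sqn_cvgP => e e0; have [N hN] := nrm_PV_P_small f e0.
by exists N => n /hN; rewrite -sqn_inner -(sqnN (inner_semi H)) opprB.
Qed.

(** Each step is Pythagoras for the larger space, applied to the projection onto the smaller one. *)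
Lemma P_telescope f m n : (m <= n)%N ->
  nrm (f - P S m f) ^+ 2 = nrm (f - P S n f) ^+ 2 +
    \sum_(m.+1 <= l < n.+1) nrm (P S l f - P S l.-1 f) ^+ 2.
Proof.
move=> /subnKC <-; elim: (n - m)%N => [|j IH].
  by rewrite addn0 big_geq // addr0.
rewrite addnS big_nat_recr /= ?ltnS ?leq_addr // IH.
rewrite (P_pythagoras f (V_le (leqnSn (m + j)) (P_V (m + j) f))).
by rewrite -addrA; congr (_ + _); rewrite addrC.
Qed.

(** By telescoping, the sum up to level [n] misses its claimed limit by exactly
    [nrm (PV S f - P S n f) ^+ 2]. *)
Lemma P_parseval f m :
  ((nrm (f - P S m f) ^+ 2)%:E =
   (nrm (f - PV S f) ^+ 2)%:E +
   \sum_(m.+1 <= l <oo) (nrm (P S l f - P S l.-1 f) ^+ 2)%:E)%E.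
Proof.
suff -> : (\sum_(m.+1 <= l <oo) (nrm (P S l f - P S l.-1 f) ^+ 2)%:E)%E =
    (nrm (f - P S m f) ^+ 2 - nrm (f - PV S f) ^+ 2)%:E.
  by rewrite -EFinD [in RHS]addrC subrK.
apply: cvg_lim => //.
under eq_fun do rewrite sumEFin.
apply: cvg_EFin; first exact: nearW.
apply/cvgrPdist_lt => e e0; have [N hN] := nrm_PV_P_small f e0.
(* The upper summation bound is exclusive, so the partial sum of index [n.+1] ends at level [n]. *)
exists (maxn N m).+1 => // -[|n] //=; rewrite ltnS geq_max => /andP[/hN Nn mn].
rewrite (P_telescope f mn) (PV_pythagoras f (V_Vinf (P_V n f))).
have cancel (a b c : R) : a + b + c - a - c = b by ring.
by rewrite cancel ger0_norm ?sqr_ge0.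
Qed.

End Approximation.

Theorem corollary2p3 (R : realType) (k : scalar_kind)
    (H : hilbertType R k) (E : nat -> hilbertType R k)
    (S : forall l, {linear E l -> H}) (C : nat -> fam E -> fam E)
    (delta Delta M K : R)
    (S_bounded : forall l, bounded_operator (S l))
    (V_closed : forall m, (0 < m)%N -> closed (V S m))
    (delta_gt0 : 0 < delta) (delta_le_Delta : delta <= Delta)
    (D_bounds : forall l (x : E l), quotE S x ->
       delta * nrm x ^+ 2 <= re (inner (D S x) x) <= Delta * nrm x ^+ 2)
    (C_iso : forall m, (0 < m)%N -> is_coordinate_iso S m (C m))
    (L_le : forall m, (0 < m)%N -> (norm_L S m (C m) <= M%:E)%E)
    (Linv_le : forall m, (0 < m)%N -> (norm_Linv S m (C m) <= K%:E)%E) :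
  let A := delta / K ^+ 2 in
  let B := Delta * M ^+ 2 in
  forall f : H,
  [/\ P S m f @[m --> \oo] --> PV S f /\
      (forall m, exists2 c,
         unique (fun c => quotS S m c /\ Sfin S m c = P S m f) c &
         fnorm c <= (Num.sqrt A)^-1 * nrm (P S m f)),
      (forall (c : fam E) m, Ehat S c -> Sinf S c = PV S f ->
         nrm (PV S f - Sinf S (Q S m c))
           <= Num.sqrt B * fnorm (fsub c (Q S m c))) &
      (forall m,
         (nrm (f - P S m f) ^+ 2)%:E =
         ((nrm (f - PV S f) ^+ 2)%:E +
          \sum_(m.+1 <= l <oo) (nrm (P S l f - P S l.-1 f) ^+ 2)%:E)%E)].
Proof.
move=> A B f.
have Delta_ge0 : 0 <= Delta by rewrite (le_trans _ delta_le_Delta) ?ltW.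
have delta_ge0 := ltW delta_gt0; split=> [|c m Xc ScE|m]; last exact: P_parseval.
- split=> [|m]; first exact: P_cvg.
  have [c0 c0m Pc0] := P_V V_closed m f.
  have [c [Xc Sc _]] := quotS_decomposition S_bounded c0m.
  exists c.
    split=> [|x [Xx Sx]]; first by rewrite Sc Pc0.
    (* Uniqueness: the difference is both in the kernel of [Sfin S m] and orthogonal to it. *)
    have Xd : quotS S m (c - x) := subspaceB (subspace_quotS S m) Xc Xx.
    apply/eqP; rewrite -subr_eq0; apply/eqP.
    apply: (dotn_definite (quotS_finsum Xd)).
    move: (Xd); rewrite quotSE /sqn => -[dm ->]; first exact: re0.
    split=> //; rewrite addrC -scaleN1r Sfin_linear scaleN1r Sx Sc Pc0.
    exact: addNr.
  (* The hypotheses on [C m] start at [m = 1]; for [m = 0] the coefficient has norm zero. *)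
  rewrite -Pc0 -Sc; case: m c0m Pc0 Xc Sc => [|m] c0m Pc0 Xc Sc.
    rewrite (fnormE (quotS_finsum Xc)) sqn_dotn big_ord0 sqrtr0.
    by rewrite mulr_ge0 ?invr_ge0 ?sqrtr_ge0 ?nrm_ge0.
  have := frame_lower S_bounded V_closed delta_ge0 D_bounds
    (C_iso _ (ltn0Sn m)) (Linv_le _ (ltn0Sn m)) Xc.
  have n0 := fnorm_ge0 c; have s0 := nrm_ge0 (Sfin S m.+1 c).
  (* If [K = 0], division by zero makes [A] equal to 0, but the lower frame inequality then forces
     [fnorm c = 0]. *)
  have [K0|K0] := eqVneq K 0 => h.
    rewrite (_ : fnorm c = 0) ?mulr_ge0 ?invr_ge0 ?sqrtr_ge0 //.
    apply/eqP; rewrite -sqrf_eq0 eq_le sqr_ge0 andbT.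
    by move: h; rewrite K0 expr0n mul0r pmulr_rle0.
  have K2 : 0 < K ^+ 2 by rewrite lt_def sqrf_eq0 K0 sqr_ge0.
  have A0 : 0 <= A by rewrite divr_ge0 // ltW.
  rewrite -ler_sqr ?nnegrE ?mulr_ge0 ?invr_ge0 ?sqrtr_ge0 //.
  rewrite exprMn exprVn (sqr_sqrtr A0) /A invf_div mulrAC ler_pdivlMr //.
  by rewrite mulrC.
- have hb n x : finsum n x -> nrm (Sfin S n x) <= Num.sqrt B * fnorm x.
    (* Viewing [x] with one more level brings [n = 0] under the hypotheses. *)
    move=> xn; rewrite -(SfinE S xn (leqnSn n)).
    exact: (frame_upper S_bounded V_closed Delta_ge0 D_bounds (C_iso _ (ltn0Sn n))
      (L_le _ (ltn0Sn n)) (finsum_le (leqnSn n) xn)).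
  rewrite -ScE; apply: (Sinf_sub_le (sqrtr_ge0 _) hb); first by case: Xc.
  (* Whether [xget] returns an element of [Ehat] or the default [fzero], the result is in [l2sum],
     where the bound on [Sinf] holds. *)
  rewrite /Q; case: xgetP => [d _ [[dl _] _] //|_].
  by apply: (@finsum_l2sum _ _ _ 0) => l _.
Qed.
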